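(* For each $n$, let $p=p(n)$ and $\rho=\rho(n)\in\mathbb{R}^p$, and let $\sigma>0$ be a fixed constant. Observe $x_1,\dots,x_n\in\mathbb{R}^p$ from the single component model $$x_i = v_i\rho+\sigma z_i,\qquad i=1,\dots,n,$$ where $v_1,\dots,v_n$ are i.i.d. $N(0,1)$, $z_1,\dots,z_n$ are i.i.d. $N_p(0,I_p)$, and all the $v_i$ and $z_i$ are mutually independent. Assume $\lim_{n\to\infty}\|\rho(n)\|=\varrho>0$ and $\lim_{n\to\infty}p(n)/n=c$ with $0<c<\infty$. Let $S=n^{-1}\sum_{i=1}^n x_ix_i^T$ and let $\hat\rho$ be a unit eigenvector of $S$ associated with its largest eigenvalue. Then $\hat\rho$ is inconsistent: $$\liminf_{n\to\infty} E\,\angle(\hat\rho,\rho)>0.$$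
   Context: For nonzero $\xi,\eta\in\mathbb{R}^p$, the angle is $\angle(\xi,\eta)=\cos^{-1}\bigl(|\xi^T\eta|/(\|\xi\|_2\|\eta\|_2)\bigr)\in[0,\pi/2]$. All quantities $p,\rho$ may depend on $n$; $\sigma$ does not. *)

(* Defs.v *)
From HB Require Import structures.
From mathcomp Require Import all_boot all_order all_algebra.
From mathcomp Require Import all_classical all_reals all_analysis.
Set Implicit Arguments. Unset Strict Implicit. Unset Printing Implicit Defensive.
Import Order.TTheory GRing.Theory Num.Theory.
Local Open Scope ring_scope.
Local Open Scope classical_set_scope.

Definition vnorm (R : realType) (p : nat) (x : 'cV[R]_p) : R :=
  Num.sqrt (\sum_(i < p) x i 0 ^+ 2).

Definition vdot (R : realType) (p : nat) (x y : 'cV[R]_p) : R :=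
  \sum_(i < p) x i 0 * y i 0.

Definition vangle (R : realType) (p : nat) (x y : 'cV[R]_p) : R :=
  acos (`|vdot x y| / (vnorm x * vnorm y)).

Definition top_unit_eigvec (R : realType) (p : nat) (S : 'M[R]_p) (u : 'cV[R]_p) : Prop :=
  vnorm u = 1 /\
  exists lam : R, S *m u = lam *: u /\
    (forall (mu : R) (w : 'cV[R]_p), w != 0 -> S *m w = mu *: w -> mu <= lam).

Definition mutually_independent (R : realType) (d : measure_display)
    (T : measurableType d) (P : probability T R) (I : finType)
    (X : I -> T -> R) : Prop :=
  (forall i, measurable_fun setT (X i)) /\
  forall B : I -> set R, (forall i, measurable (B i)) ->
    P (\bigcap_(i in [set: I]) (X i @^-1` B i)) =
    (\prod_(i : I) P (X i @^-1` B i))%E.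

Definition std_normal (R : realType) (d : measure_display)
    (T : measurableType d) (P : probability T R) (X : T -> R) : Prop :=
  forall B : set R, measurable B -> P (X @^-1` B) = normal_prob 0 1 B.

Definition sample_cov (R : realType) (p n : nat) (x : 'I_n -> 'cV[R]_p) : 'M[R]_p :=
  n%:R^-1 *: \sum_(i < n) (x i *m (x i)^T).

(* Main.v *)
(* Let e = rho / |rho|, alpha = e^T S e and q = S e - alpha e. For the top unit
   eigenvector u with eigenvalue lam, Cauchy-Schwarz for the form of S gives
   |S e|^2 <= alpha lam, and (lam - alpha) (u . e) = u . q, so that
   |q|^2 (u . e)^2 <= alpha^2 (1 - (u . e)^2). Hence the angle between u and rho
   is bounded below on the event {alpha <= K, |q|^2 >= t}, and no bound on the
   operator norm of S is needed.

   The event has probability bounded below: alpha has bounded mean, and, writing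
   W = sum_i v_i z_i, the part of q that is odd in v is
   (sigma |rho| / n) (W - (e . W) e). Since v and -v have the same law, |q| is at
   least as large as this part with at least half the probability. The squared
   norm |W|^2 - (e . W)^2 is handled by the Paley-Zygmund inequality, whose
   moment bounds follow from flipping the signs of single coordinates z_ij. Only
   the symmetry of the standard normal law, m2 = E z^2 > 0 and m4 = E z^4 < oo
   are used. *)

Require Import Defs.
From HB Require Import structures.
From mathcomp Require Import all_boot all_order all_algebra.
From mathcomp Require Import all_classical all_reals all_analysis.
From mathcomp Require Import measurable_realfun.
From mathcomp Require Import ring lra.
Import Order.TTheory GRing.Theory Num.Theory numFieldNormedType.Exports.
Local Open Scope ring_scope.
Local Open Scope classical_set_scope.
Set Implicit Arguments. Unset Strict Implicit. Unset Printing Implicit Defensive.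

(** * The deterministic angle bound *)

(** For [a > 0] the choice [(s, t) = (-b, a)] gives [a (a c - b^2) >= 0], and [c > 0] is symmetric.
    When [a = c = 0], [(1, -b)] gives [-2 b^2 >= 0]. This is the common source of all Cauchy-Schwarz
    inequalities below, including those for degenerate forms. *)
Lemma discriminant_le (R : realFieldType) (a b c : R) :
  (forall s t, 0 <= s ^+ 2 * a + 2 * (s * t) * b + t ^+ 2 * c) ->
  b ^+ 2 <= a * c.
Proof.
move=> h; have a0 : 0 <= a by have := h 1 0; lra.
have c0 : 0 <= c by have := h 0 1; lra.
have [a_gt0|a_le0] := ltP 0 a.
  by rewrite -subr_ge0 -(pmulr_rge0 _ a_gt0); have := h (- b) a; nra.
have [c_gt0|c_le0] := ltP 0 c.
  by rewrite -subr_ge0 -(pmulr_rge0 _ c_gt0); have := h c (- b); nra.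
have -> : a = 0 by lra.
by have := h 1 (- b); have -> : c = 0; nra.
Qed.

(** * Euclidean inner product and the Rayleigh bound *)

Section InnerProduct.
Context (R : realType) (p : nat).
Implicit Types (f g h : 'cV[R]_p) (k : R).

Lemma vdotC f g : vdot f g = vdot g f.
Proof. by apply: eq_bigr => i _; rewrite mulrC. Qed.

Lemma vdotDr f g h : vdot f (g + h) = vdot f g + vdot f h.
Proof. by rewrite -big_split; apply: eq_bigr => i _; rewrite mxE mulrDr. Qed.

Lemma vdotZr k f g : vdot f (k *: g) = k * vdot f g.
Proof. by rewrite mulr_sumr; apply: eq_bigr => i _; rewrite mxE mulrCA. Qed.

Lemma vdotDl f g h : vdot (f + g) h = vdot f h + vdot g h.
Proof. by rewrite ![vdot _ h]vdotC vdotDr. Qed.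

Lemma vdotZl k f g : vdot (k *: f) g = k * vdot f g.
Proof. by rewrite ![vdot _ g]vdotC vdotZr. Qed.

Lemma vdotBr f g h : vdot f (g - h) = vdot f g - vdot f h.
Proof. by rewrite vdotDr -scaleN1r vdotZr mulN1r. Qed.

Lemma vdotBl f g h : vdot (f - g) h = vdot f h - vdot g h.
Proof. by rewrite ![vdot _ h]vdotC vdotBr. Qed.

Lemma vdot_sumr (I : finType) (F : I -> 'cV[R]_p) f :
  vdot f (\sum_i F i) = \sum_i vdot f (F i).
Proof.
rewrite exchange_big /=; apply: eq_bigr => j _.
by rewrite summxE mulr_sumr.
Qed.

Lemma vdotff_ge0 f : 0 <= vdot f f.
Proof. by apply: sumr_ge0 => i _; rewrite -expr2 sqr_ge0. Qed.

Lemma vdotff_eq0 f : (vdot f f == 0) = (f == 0).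
Proof.
apply/eqP/eqP => [/eqP|->]; last by rewrite /vdot big1// => i _; rewrite mxE mul0r.
rewrite psumr_eq0 => [/allP f0|i _]; last by rewrite -expr2 sqr_ge0.
apply/colP => i; have := f0 i (mem_index_enum i).
by rewrite /= mulf_eq0 orbb mxE => /eqP.
Qed.

Lemma vnormE f : vnorm f = Num.sqrt (vdot f f).
Proof. by rewrite /vnorm; congr Num.sqrt; apply: eq_bigr => i _; rewrite expr2. Qed.

Lemma sqr_vnorm f : vnorm f ^+ 2 = vdot f f.
Proof. by rewrite vnormE sqr_sqrtr// vdotff_ge0. Qed.

Lemma vnorm_ge0 f : 0 <= vnorm f.
Proof. exact: sqrtr_ge0. Qed.

Lemma vdot_delta f (i : 'I_p) : vdot (delta_mx i 0) f = f i 0.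
Proof.
rewrite /vdot (bigD1 i)//= !mxE !eqxx mul1r big1 ?addr0// => j ji.
by rewrite mxE (negbTE ji) mul0r.
Qed.

Lemma vdot_mulmx (A : 'M[R]_p) f g : vdot f (A *m g) = vdot (A^T *m f) g.
Proof.
have E u w : vdot u w = (u^T *m w) 0 0.
  by rewrite mxE; apply: eq_bigr => i _; rewrite mxE.
by rewrite !E trmx_mul trmxK mulmxA.
Qed.

Lemma vdot_sqr_le f g : vdot f g ^+ 2 <= vdot f f * vdot g g.
Proof.
apply: discriminant_le => s t; have := vdotff_ge0 (s *: f + t *: g).
rewrite !(vdotDl, vdotDr, vdotZl, vdotZr) (vdotC g f); lra.
Qed.

(* A maximiser of the quadratic form on the unit sphere is an eigenvector: it
   annihilates the positive semidefinite form [M |f|^2 - f^T A f]. *)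
Lemma rayleigh_le (A : 'M[R]_p) (lam : R) : A^T = A ->
  (forall mu (w : 'cV[R]_p), w != 0 -> A *m w = mu *: w -> mu <= lam) ->
  forall f, vdot f (A *m f) <= lam * vdot f f.
Proof.
move=> symA top f.
have [->|f0] := eqVneq f 0.
  by rewrite mulmx0 (eqP (_ : vdot 0 0 == 0)) ?vdotff_eq0// mulr0.
have f_gt0 : 0 < vdot f f by rewrite lt_def vdotff_eq0 f0 vdotff_ge0.
(* The sphere lives in row vectors, the type for which [bounded_closed_compact] gives
   compactness. *)
pose form (r : 'rV[R]_p) := vdot r^T (A *m r^T).
pose sphere := [set r : 'rV[R]_p | vdot r^T r^T = 1].
have csum m (F : 'I_m -> 'rV[R]_p -> R) : (forall i, continuous (F i)) ->
    continuous (fun r => \sum_(i < m) F i r).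
  by move=> cF; apply: continuous_big => //; exact: add_continuous.
have centry i : continuous (fun r : 'rV[R]_p => r^T i 0).
  rewrite (_ : (fun _ => _) = fun r : 'rV[R]_p => r 0 i); first exact: coord_continuous.
  by apply/funext => r; rewrite mxE.
have cvdot (B : 'M[R]_p) : continuous (fun r : 'rV[R]_p => vdot r^T (B *m r^T)).
  apply: (csum) => i r.
  have cB : continuous (fun s : 'rV[R]_p => (B *m s^T) i 0).
    rewrite (_ : (fun _ => _) = fun s : 'rV[R]_p => \sum_j B i j * s^T j 0).
      by apply: (csum) => j s; exact: (cvgM (@cvg_cst _ _ _ _ _) (centry j s)).
    by apply/funext => s; rewrite mxE.
  exact: (cvgM (centry i r) (cB r)).
have compact_sphere : compact sphere.
  apply: bounded_closed_compact.
    exists 1; split; first exact: num_real.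
    move=> M M1 r /= r1; rewrite (le_trans _ (ltW M1))//.
    rewrite [leLHS]/Num.norm/= mx_normrE; apply: bigmax_le => //= -[i j] _ /=.
    rewrite ord1 -(@ler_pXn2r _ 2)// ?nnegrE// real_normK ?num_real//.
    rewrite expr1n -r1 /vdot (bigD1 j)//= !mxE -expr2 lerDl.
    by apply: sumr_ge0 => k _; rewrite -expr2 sqr_ge0.
  rewrite (_ : sphere =
      (fun r : 'rV[R]_p => vdot r^T (1%:M *m r^T)) @^-1` [set x | x = 1]).
    by apply: preimage_closed; [move=> r _; exact: cvdot|exact: closed_eq].
  by apply/seteqP; split => r /=; rewrite mul1mx.
have unit_f : vdot ((Num.sqrt (vdot f f))^-1 *: f)
                   ((Num.sqrt (vdot f f))^-1 *: f) = 1.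
  rewrite vdotZl vdotZr mulrA -invfM -expr2 sqr_sqrtr ?vdotff_ge0//.
  by rewrite mulVf// gt_eqF.
have sphere_neq0 : sphere !=set0.
  by exists ((Num.sqrt (vdot f f))^-1 *: f)^T; rewrite /sphere/= trmxK.
have cform : {within sphere, continuous form}.
  by apply: continuous_subspaceT; exact: cvdot.
have [r0 /set_mem/= r01 max_r0] :=
  compact_EVT_max sphere_neq0 compact_sphere cform.
pose M := form r0; pose w := r0^T.
(* Homogeneity carries the maximum from the sphere to all vectors. *)
have M_max g : 0 <= M * vdot g g - vdot g (A *m g).
  have [->|g0] := eqVneq g 0.
    by rewrite mulmx0 (eqP (_ : vdot 0 0 == 0)) ?vdotff_eq0// mulr0 subr0.
  have g_gt0 : 0 < vdot g g by rewrite lt_def vdotff_eq0 g0 vdotff_ge0.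
  have := max_r0 ((Num.sqrt (vdot g g))^-1 *: g)^T.
  rewrite inE /sphere /form /= trmxK -scalemxAr !(vdotZl, vdotZr) !mulrA.
  rewrite -invfM -expr2 sqr_sqrtr ?vdotff_ge0// mulVf ?gt_eqF// => /(_ erefl).
  by rewrite mulrC ler_pdivrMr// subr_ge0.
have null g : vdot (M *: w - A *m w) g = 0.
  have sym : vdot g (A *m w) = vdot (A *m w) g by rewrite vdotC.
  have symg : vdot w (A *m g) = vdot (A *m w) g by rewrite vdot_mulmx symA.
  have Mw : vdot w (A *m w) = M by [].
  (* The coefficient of [s^2] is the value of the semidefinite form at [w], namely [M - M = 0], so
     the discriminant bound forces the mixed coefficient to vanish. *)
  have /discriminant_le : forall s t, 0 <= s ^+ 2 * 0 +
      2 * (s * t) * vdot (M *: w - A *m w) g +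
      t ^+ 2 * (M * vdot g g - vdot g (A *m g)).
    move=> s t; have := M_max (s *: w + t *: g).
    rewrite mulmxDr -!scalemxAr vdotBl vdotZl.
    rewrite !(vdotDl, vdotDr, vdotZl, vdotZr) (vdotC g w) sym symg Mw r01.
    by apply: etrans; congr (0 <= _); ring.
  by rewrite mul0r => null2; apply/eqP; rewrite -sqrf_eq0 eq_le null2 sqr_ge0.
have Mlam : M <= lam.
  apply: (top M w); first by rewrite -vdotff_eq0 r01 oner_eq0.
  by have /eqP := null (M *: w - A *m w); rewrite vdotff_eq0 subr_eq0 => /eqP.
have := M_max f; nra.
Qed.

End InnerProduct.

(** * Residual of a unit vector and the top eigenvector of [S] *)

Section TopEigenvector.
Context (R : realType) (p n : nat) (x : 'I_n -> 'cV[R]_p).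
Implicit Types (e f g u : 'cV[R]_p).
Local Notation S := (sample_cov x).

Lemma vdot_sample_cov f g :
  vdot f (S *m g) = n%:R^-1 * \sum_(i < n) vdot (x i) f * vdot (x i) g.
Proof.
rewrite /sample_cov -scalemxAl vdotZr mulmx_suml vdot_sumr; congr (_ * _).
apply: eq_bigr => i _; rewrite -mulmxA.
have -> : (x i)^T *m g = (vdot (x i) g)%:M.
  rewrite [LHS]mx11_scalar; congr (_%:M); rewrite mxE.
  by apply: eq_bigr => j _; rewrite mxE.
by rewrite mul_mx_scalar vdotZr mulrC (vdotC f).
Qed.

Lemma sample_cov_sym : S^T = S.
Proof.
rewrite /sample_cov linearZ/= linear_sum/=; congr (_ *: _).
by apply: eq_bigr => i _; rewrite trmx_mul trmxK.
Qed.

Lemma sample_cov_form_sqr_le f g :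
  vdot f (S *m g) ^+ 2 <= vdot f (S *m f) * vdot g (S *m g).
Proof.
apply: discriminant_le => s t.
rewrite (_ : _ + _ = vdot (s *: f + t *: g) (S *m (s *: f + t *: g))).
  rewrite vdot_sample_cov mulr_ge0// sumr_ge0// => i _.
  by rewrite -expr2 sqr_ge0.
rewrite mulmxDr -!scalemxAr !(vdotDl, vdotDr, vdotZl, vdotZr).
by rewrite [vdot g (S *m f)]vdot_mulmx sample_cov_sym [vdot (S *m g) f]vdotC; ring.
Qed.

Let alpha e := vdot e (S *m e).
Let q e := S *m e - alpha e *: e.

(* The top eigenvalue [lam] satisfies [|S e|^2 <= alpha * lam] by Cauchy-Schwarz
   for the form of [S], while [(lam - alpha) (u . e) = u . q]. *)
Lemma top_eigvec_residual e u : vdot e e = 1 -> top_unit_eigvec S u ->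
  vdot (q e) (q e) * vdot u e ^+ 2 <= alpha e ^+ 2 * (1 - vdot u e ^+ 2).
Proof.
move=> e1 [u1 [lam [Su top]]].
have uu : vdot u u = 1 by rewrite -sqr_vnorm u1 expr1n.
have ray := rayleigh_le sample_cov_sym top.
set f := S *m e; set a := vdot u e; set al := alpha e; set Q := vdot _ _.
have al0 : 0 <= al.
  rewrite /al /alpha vdot_sample_cov mulr_ge0// sumr_ge0// => i _.
  by rewrite -expr2 sqr_ge0.
have qe : vdot e (q e) = 0 by rewrite vdotBr vdotZr e1 mulr1 subrr.
have Qf : vdot f f = Q + al ^+ 2.
  rewrite (_ : f = q e + al *: e); last by rewrite subrK.
  rewrite /Q; move: (q e) qe => r re.
  by rewrite !(vdotDl, vdotDr, vdotZl, vdotZr) e1 (vdotC r e) re; ring.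
have Q0 : 0 <= Q by exact: vdotff_ge0.
have lam0 : 0 <= lam.
  have := ray u; rewrite uu mulr1; apply: le_trans.
  rewrite vdot_sample_cov mulr_ge0// sumr_ge0// => i _.
  by rewrite -expr2 sqr_ge0.
(* With [f = S e], [|f|^4 = (e^T S f)^2 <= al (f^T S f) <= al lam |f|^2]; then divide by [|f|^2]. *)
have fal : vdot f f <= al * lam.
  have [f0|f_gt0] := leP (vdot f f) 0; first by rewrite (le_trans f0)// mulr_ge0.
  rewrite -(ler_pM2r f_gt0).
  have -> : vdot f f * vdot f f = vdot e (S *m f) ^+ 2.
    by rewrite vdot_mulmx sample_cov_sym expr2.
  apply: le_trans (sample_cov_form_sqr_le e f) _.
  by rewrite -mulrA ler_wpM2l.
(* Since [q e] is orthogonal to [e], the part [a e] of [u] may be removed. Cauchy-Schwarz then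
   produces the factor [|u - a e|^2 = 1 - a^2] instead of [1]. *)
have ua : (lam - al) * a = vdot (u - a *: e) (q e).
  rewrite vdotBl vdotZl qe mulr0 subr0 vdotBr vdotZr -/a mulrBl.
  by rewrite vdot_mulmx sample_cov_sym Su vdotZl.
have ua2 : ((lam - al) * a) ^+ 2 <= (1 - a ^+ 2) * Q.
  rewrite ua; apply: le_trans (vdot_sqr_le _ _) _.
  rewrite ler_wpM2r// !(vdotBl, vdotBr, vdotZl, vdotZr) uu e1 (vdotC e u) -/a.
  by rewrite le_eqVlt; apply/orP; left; apply/eqP; ring.
have QA : Q <= al * (lam - al) by move: fal; rewrite Qf; lra.
have a1 : 0 <= 1 - a ^+ 2.
  by have := vdot_sqr_le u e; rewrite uu e1 mulr1 -/a; lra.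
have [Q_le0|Q_gt0] := leP Q 0.
  by rewrite (le_trans (_ : _ <= 0)) ?mulr_ge0 ?sqr_ge0// mulr_le0_ge0 ?sqr_ge0.
(* After multiplication by [Q], the chain is [Q^2 a^2 <= al^2 ((lam - al) a)^2 <= al^2 (1 - a^2) Q],
   which eliminates [lam]. *)
rewrite -(ler_pM2l Q_gt0).
have : Q ^+ 2 * a ^+ 2 <= (al * (lam - al)) ^+ 2 * a ^+ 2.
  by rewrite ler_wpM2r ?sqr_ge0// ler_pXn2r ?nnegrE// (le_trans Q0).
have : al ^+ 2 * ((lam - al) * a) ^+ 2 <= al ^+ 2 * ((1 - a ^+ 2) * Q).
  by rewrite ler_wpM2l ?sqr_ge0.
rewrite !exprMn; nra.
Qed.

(** With [a = u . e], the residual bound gives [t a^2 <= K^2 (1 - a^2)], hence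
    [a^2 <= K^2 / (K^2 + t)]. The angle is [acos |a|], and [acos] is decreasing. *)
Lemma vangle_ge (rho u : 'cV[R]_p) (K t : R) :
  let e := (vnorm rho)^-1 *: rho in
  0 < vnorm rho -> top_unit_eigvec S u -> 0 < t ->
  alpha e <= K -> t <= vdot (q e) (q e) ->
  acos (Num.sqrt (K ^+ 2 / (K ^+ 2 + t))) <= vangle u rho.
Proof.
move=> e rho0 topu t0 alK tq.
have e1 : vdot e e = 1.
  by rewrite /e vdotZl vdotZr -sqr_vnorm; field; rewrite gt_eqF.
have := top_eigvec_residual e1 topu.
case: topu => u1 _.
have -> : vangle u rho = acos `|vdot u e|.
  by rewrite /vangle /e vdotZr u1 mul1r normrM mulrC ger0_norm// invr_ge0 ltW.
set a := vdot u e; set Q := vdot _ _ => aQ.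
have al0 : 0 <= alpha e.
  rewrite /alpha vdot_sample_cov mulr_ge0// sumr_ge0// => i _.
  by rewrite -expr2 sqr_ge0.
have a1 : a ^+ 2 <= 1.
  have := vdot_sqr_le u e; rewrite e1 mulr1 -/a => /le_trans; apply.
  by rewrite -sqr_vnorm u1 expr1n.
have K2 : alpha e ^+ 2 <= K ^+ 2 by rewrite ler_pXn2r ?nnegrE ?(le_trans al0).
have aK : a ^+ 2 <= K ^+ 2 / (K ^+ 2 + t).
  rewrite ler_pdivlMr; last by have := sqr_ge0 K; lra.
  have : t * a ^+ 2 <= Q * a ^+ 2 by rewrite ler_wpM2r ?sqr_ge0.
  have : alpha e ^+ 2 * (1 - a ^+ 2) <= K ^+ 2 * (1 - a ^+ 2).
    by rewrite ler_wpM2r// subr_ge0.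
  lra.
have s1 : K ^+ 2 / (K ^+ 2 + t) <= 1.
  by rewrite ler_pdivrMr; have := sqr_ge0 K; lra.
have na : `|a| <= 1 by rewrite -sqrtr_sqr -[leRHS]sqrtr1 ler_sqrt.
have ns : Num.sqrt (K ^+ 2 / (K ^+ 2 + t)) <= 1.
  by rewrite -[leRHS]sqrtr1 ler_sqrt.
have as' : `|a| <= Num.sqrt (K ^+ 2 / (K ^+ 2 + t)).
  by rewrite -sqrtr_sqr ler_sqrt// (le_trans _ aK) ?sqr_ge0.
have i1 : Num.sqrt (K ^+ 2 / (K ^+ 2 + t)) \in `[-1, 1]%R.
  by rewrite in_itv/= ns (le_trans _ (sqrtr_ge0 _)).
have i2 : `|a| \in `[-1, 1]%R by rewrite in_itv/= na (le_trans _ (normr_ge0 _)).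
(* Monotonicity of [acos] is obtained by contradiction from the strict decrease of [cos] on
   [[0, pi]]. *)
rewrite leNgt; apply/negP => lta.
have : cos (acos (Num.sqrt (K ^+ 2 / (K ^+ 2 + t)))) < cos (acos `|a|).
  rewrite ltr_cos// in_itv/= ?acos_ge0 ?acos_lepi//.
by rewrite !acosK// ltNge as'.
Qed.

End TopEigenvector.

(** * Sign-symmetric sums and Paley-Zygmund *)

Section NonnegExpectation.
Context (R : realType) (d : measure_display) (T : measurableType d).
Variable mu : {measure set T -> \bar R}.
Implicit Types (f g : T -> R).
Local Notation E f := (\int[mu]_x (f x)%:E)%E.

Lemma expect_ge0 f : (forall x, 0 <= f x) -> (0 <= E f)%E.
Proof. by move=> f0; apply: integral_ge0 => x _; rewrite lee_fin. Qed.

Lemma expectD f g : measurable_fun setT f -> (forall x, 0 <= f x) ->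
  measurable_fun setT g -> (forall x, 0 <= g x) ->
  E (fun x => f x + g x) = (E f + E g)%E.
Proof.
move=> mf f0 mg g0; under eq_integral do rewrite EFinD.
by rewrite ge0_integralD//; try (by move=> x _; rewrite lee_fin);
  exact/measurable_EFinP.
Qed.

Lemma expectZ (k : R) f : 0 <= k -> measurable_fun setT f ->
  (forall x, 0 <= f x) -> E (fun x => k * f x) = (k%:E * E f)%E.
Proof.
move=> k0 mf f0; under eq_integral do rewrite EFinM.
rewrite ge0_integralZl//; first exact/measurable_EFinP.
by move=> x _; rewrite lee_fin.
Qed.

Lemma expect_sum (I : Type) (s : seq I) (f : I -> T -> R) :
  (forall i, measurable_fun setT (f i)) -> (forall i x, 0 <= f i x) ->
  E (fun x => \sum_(i <- s) f i x) = (\sum_(i <- s) E (f i))%E.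
Proof.
move=> mf f0; under eq_integral do rewrite -sumEFin.
rewrite ge0_integral_sum// => [i|i x _]; first exact/measurable_EFinP.
by rewrite lee_fin.
Qed.

Lemma expect_le f g : measurable_fun setT f -> measurable_fun setT g ->
  (forall x, 0 <= f x) -> (forall x, f x <= g x) -> (E f <= E g)%E.
Proof.
move=> mf mg f0 fg.
by apply: ge0_le_integral => //; try exact/measurable_EFinP;
  move=> x _; rewrite lee_fin.
Qed.

Definition preserves (tau : T -> T) :=
  measurable_fun setT tau /\ forall A, measurable A -> mu (tau @^-1` A) = mu A.

Lemma expect_preserves tau f : preserves tau -> measurable_fun setT f ->
  (forall x, 0 <= f x) -> E (f \o tau) = E f.
Proof.
move=> [mtau ptau] mf f0.
transitivity (\int[pushforward mu tau]_x (f x)%:E)%E.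
  rewrite ge0_integral_pushforward//; first exact/measurable_EFinP.
  by move=> x _; rewrite lee_fin.
by apply: eq_measure_integral => A mA _; exact: ptau.
Qed.

(** Averaging over [tau] cancels the terms odd under [tau]. Only nonnegative functions are
    integrated, so the odd terms never have to be shown integrable. *)
Lemma expect_symmetrize tau f g : preserves tau -> measurable_fun setT f ->
  (forall x, 0 <= f x) -> (forall x, g x = 2^-1 * (f x + f (tau x))) ->
  E f = E g.
Proof.
move=> ptau mf f0 gE.
have mft : measurable_fun setT (f \o tau) by apply: measurableT_comp => //; case: ptau.
have -> : g = fun x => 2^-1 * f x + 2^-1 * (f \o tau) x.
  by apply/funext => x; rewrite gE mulrDr.
rewrite expectD//; try (by move=> x; rewrite mulr_ge0//=; exact: f0);
  try exact: measurable_funM.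
rewrite !expectZ// ?expect_preserves//; last by move=> x; exact: f0.
rewrite -ge0_muleDl ?lee_fin//.
by rewrite -EFinD (_ : 2^-1 + 2^-1 = 1 :> R) ?mul1e//; field.
Qed.

End NonnegExpectation.

(** * Second and fourth moments of sums with independently flippable signs *)

Section SignSymmetricSums.
Context (R : realType) (d : measure_display) (T : measurableType d).
Variable mu : {measure set T -> \bar R}.
Context (I : eqType) (a : I -> T -> R) (tau : I -> T -> T).
Hypothesis ptau : forall k, preserves mu (tau k).
Hypothesis ma : forall k, measurable_fun setT (a k).
Hypothesis flip_a : forall k x, a k (tau k x) = - a k x.
Hypothesis fix_a : forall k l x, k != l -> a l (tau k x) = a l x.
Local Notation E f := (\int[mu]_x (f x)%:E)%E.

Let msum s : measurable_fun setT (fun x => \sum_(k <- s) a k x).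
Proof. exact: measurable_sum. Qed.

Let msumsq s : measurable_fun setT (fun x => \sum_(k <- s) a k x ^+ 2).
Proof. by apply: measurable_sum => k; exact: measurable_funX. Qed.

Let sumsq_ge0 s x : 0 <= \sum_(k <- s) a k x ^+ 2.
Proof. by apply: sumr_ge0 => k _; exact: sqr_ge0. Qed.

Let sum_tau s k x : k \notin s ->
  \sum_(l <- s) a l (tau k x) = \sum_(l <- s) a l x.
Proof.
move=> ks; apply: eq_big_seq => l ls; rewrite fix_a//.
by apply: contraNneq ks => ->.
Qed.

(** Induction on [s]: flipping the sign of the head term cancels its cross product with the rest.
    The invariant weight [g] allows reuse in the fourth moment, with [g] the square of a further
    term. *)
Lemma expect_sqr_sum (s : seq I) (g : T -> R) : uniq s ->
  measurable_fun setT g -> (forall x, 0 <= g x) ->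
  (forall k x, k \in s -> g (tau k x) = g x) ->
  E (fun x => (\sum_(k <- s) a k x) ^+ 2 * g x) =
  E (fun x => (\sum_(k <- s) a k x ^+ 2) * g x).
Proof.
move=> us mg g0; elim: s us => [_ _|k s IH /= /andP[ks us] gtau].
  by apply: eq_integral => x _; rewrite !big_nil expr0n.
have gs l x : l \in s -> g (tau l x) = g x.
  by move=> ls; rewrite gtau// inE ls orbT.
rewrite (@expect_symmetrize _ _ _ mu (tau k) _
    (fun x => a k x ^+ 2 * g x + (\sum_(l <- s) a l x) ^+ 2 * g x))//.
- rewrite expectD ?IH//.
  + rewrite -expectD//.
    * by apply: eq_integral => x _; rewrite big_cons mulrDl.
    * by apply: measurable_funM => //; exact: measurable_funX.
    * by move=> x; rewrite mulr_ge0 ?sqr_ge0.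
    * exact: measurable_funM.
    * by move=> x; rewrite mulr_ge0.
  + by apply: measurable_funM => //; exact: measurable_funX.
  + by move=> x; rewrite mulr_ge0 ?sqr_ge0.
  + by apply: measurable_funM => //; exact: measurable_funX.
  + by move=> x; rewrite mulr_ge0 ?sqr_ge0.
- by apply: measurable_funM => //; exact: measurable_funX.
- by move=> x; rewrite mulr_ge0 ?sqr_ge0.
- move=> x; rewrite gtau ?mem_head// !big_cons flip_a sum_tau//.
  by field.
Qed.

(** A Khintchine-type inequality. Flipping the head term [a] of [a + S] leaves
    [a^4 + 6 a^2 S^2 + S^4]; the middle term is handled by [expect_sqr_sum], the last by
    induction. *)
Lemma expect_pow4_sum (s : seq I) : uniq s ->
  (E (fun x => (\sum_(k <- s) a k x) ^+ 4) <=
   3%:E * E (fun x => (\sum_(k <- s) a k x ^+ 2) ^+ 2))%E.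
Proof.
elim: s => [_|k s IH /= /andP[ks us]].
  rewrite [leLHS](_ : _ = 0%E).
    by rewrite mule_ge0// expect_ge0// => x; exact: sqr_ge0.
  by under eq_integral do rewrite big_nil expr0n/=; rewrite integral0.
have mS := msum s; have mQ := msumsq s; have mk := ma k.
have Q0 := sumsq_ge0 s.
have pow4_ge0 (y : R) : 0 <= y ^+ 4 by rewrite (exprM y 2 2) sqr_ge0.
rewrite (@expect_symmetrize _ _ _ mu (tau k) _
    (fun x => a k x ^+ 4 + (6 * ((\sum_(l <- s) a l x) ^+ 2 * a k x ^+ 2) +
      (\sum_(l <- s) a l x) ^+ 4)))//; first last.
- by move=> x; rewrite !big_cons flip_a sum_tau//; field.
- exact: measurable_funX.
have m1 : measurable_fun setT (fun x => a k x ^+ 4) by exact: measurable_funX.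
have m2 : measurable_fun setT (fun x => (\sum_(l <- s) a l x) ^+ 2 * a k x ^+ 2).
  by apply: measurable_funM; exact: measurable_funX.
have m3 : measurable_fun setT (fun x => (\sum_(l <- s) a l x) ^+ 4).
  exact: measurable_funX.
have m4 : measurable_fun setT (fun x => (\sum_(l <- s) a l x ^+ 2) * a k x ^+ 2).
  by apply: measurable_funM => //; exact: measurable_funX.
have m5 : measurable_fun setT (fun x => (\sum_(l <- s) a l x ^+ 2) ^+ 2).
  exact: measurable_funX.
have n2 x : 0 <= (\sum_(l <- s) a l x) ^+ 2 * a k x ^+ 2.
  by rewrite mulr_ge0 ?sqr_ge0.
have n4 x : 0 <= (\sum_(l <- s) a l x ^+ 2) * a k x ^+ 2.
  by rewrite mulr_ge0 ?sqr_ge0.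
rewrite expectD//; last 2 first.
- by apply: measurable_funD => //; exact: measurable_funM.
- by move=> x; rewrite addr_ge0// mulr_ge0.
rewrite expectD//; last 2 first.
- exact: measurable_funM.
- by move=> x; rewrite mulr_ge0.
rewrite expectZ// expect_sqr_sum//; last 3 first.
- exact: measurable_funX.
- by move=> x; rewrite sqr_ge0.
- by move=> l x ls; rewrite fix_a//; apply: contraNneq ks => <-.
have m6 : measurable_fun setT (fun x => (\sum_(l <- k :: s) a l x ^+ 2) ^+ 2).
  exact: measurable_funX.
apply: (@le_trans _ _ (E (fun x => a k x ^+ 4) +
  (6%:E * E (fun x => (\sum_(l <- s) a l x ^+ 2) * a k x ^+ 2) +
   3%:E * E (fun x => (\sum_(l <- s) a l x ^+ 2) ^+ 2)))%E).
  by rewrite !leeD2l// IH.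
have n5 x : 0 <= (\sum_(l <- s) a l x ^+ 2) ^+ 2 by exact: sqr_ge0.
have n6 x : 0 <= (\sum_(l <- k :: s) a l x ^+ 2) ^+ 2 by exact: sqr_ge0.
rewrite -!expectZ// -expectD//; last 4 first.
- exact: measurable_funM.
- by move=> x; rewrite mulr_ge0.
- exact: measurable_funM.
- by move=> x; rewrite mulr_ge0.
rewrite -expectD//; last 2 first.
- by apply: measurable_funD; exact: measurable_funM.
- by move=> x; rewrite addr_ge0// mulr_ge0.
(* Pointwise, with [y] the head term and [Q] the other squares,
   [y^4 + 6 Q y^2 + 3 Q^2 <= 3 (y^2 + Q)^2]. *)
apply: expect_le.
- by repeat (apply: measurable_funD || apply: measurable_funM).
- by apply: measurable_funM => //; exact: measurable_funX.
- by move=> x; rewrite !addr_ge0// mulr_ge0.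
- move=> x; rewrite big_cons; set y := a k x; set Q := \sum_(l <- s) _.
  by have := pow4_ge0 y; nra.
Qed.

End SignSymmetricSums.

(* Paley-Zygmund: on [f < m / 2] bound [f] by [m / 2], elsewhere use
   [f <= (t f^2 + 1 / t) / 2] with [t = 1 / (2 C m)]. *)
Lemma paley_zygmund (R : realType) (d : measure_display) (T : measurableType d)
    (P : probability T R) (f : T -> R) (m C : R) :
  measurable_fun setT f -> (forall x, 0 <= f x) -> 0 < m -> 0 < C ->
  (m%:E <= \int[P]_x (f x)%:E)%E ->
  (\int[P]_x (f x ^+ 2)%:E <= (C * m ^+ 2)%:E)%E ->
  ((4 * C)^-1%:E <= P [set x | (m / 2 <= f x)%R])%E.
Proof.
move=> mf f0 m0 C0 fm fC; set A := [set x | _].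
have mA : measurable A.
  rewrite (_ : A = setT `&` f @^-1` `[m / 2, +oo[%classic); first exact: mf.
  by rewrite setTI; apply/seteqP; split => x /=; rewrite in_itv/= andbT.
pose t := (2 * C * m)^-1.
have t0 : 0 < t by rewrite invr_gt0 !mulr_gt0.
have := @expect_le _ _ _ P f
  (fun x => m / 2 + (t / 2 * f x ^+ 2 + (C * m) * \1_A x)).
have mf2 : measurable_fun setT (fun x => f x ^+ 2) by exact: measurable_funX.
have mi : measurable_fun setT (fun x => C * m * \1_A x).
  by apply: measurable_funM => //; exact: measurable_indic.
have mft : measurable_fun setT (fun x => t / 2 * f x ^+ 2).
  exact: measurable_funM.
have i0 x : 0 <= \1_A x :> R by rewrite indicE.
have n1 x : 0 <= t / 2 * f x ^+ 2 by rewrite mulr_ge0 ?sqr_ge0// divr_ge0// ltW.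
have n2 x : 0 <= C * m * \1_A x by rewrite mulr_ge0// mulr_ge0// ltW.
move=> /(_ mf _ f0) H.
have {}H : (\int[P]_x (f x)%:E <=
    (m / 2)%:E + ((t / 2)%:E * (C * m ^+ 2)%:E + (C * m)%:E * P A))%E.
  apply: le_trans (H _ _) _.
  - by repeat apply: measurable_funD.
  - move=> x; rewrite indicE; have [xA|xA] := boolP (x \in A).
      rewrite mulr1 (_ : t / 2 * f x ^+ 2 = f x ^+ 2 / (4 * C * m)); last first.
        by rewrite /t; field; rewrite !gt_eqF.
      have Cm : 0 < C * m by rewrite mulr_gt0.
      have : f x <= f x ^+ 2 / (4 * C * m) + C * m; last by lra.
      rewrite -subr_ge0 (_ : _ - _ = (f x - 2 * (C * m)) ^+ 2 / (4 * (C * m))).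
        by rewrite divr_ge0 ?sqr_ge0// mulr_ge0// ltW.
      by field; rewrite !gt_eqF.
    rewrite mulr0 addr0; have : f x < m / 2.
      by rewrite ltNge; apply: contra xA => xA; rewrite inE.
    by have := n1 x; lra.
  - rewrite expectD//; last 3 first.
    + by move=> x; rewrite divr_ge0// ltW.
    + exact: measurable_funD.
    + by move=> x; rewrite addr_ge0.
    rewrite expectD//.
    rewrite integral_cst//= probability_setT mule1 leeD2l//.
    have t20 : 0 <= t / 2 by rewrite divr_ge0// ltW.
    have Cm0 : 0 <= C * m by rewrite mulr_ge0// ltW.
    rewrite !expectZ//;
      try exact: measurable_indic; try (by move=> x; exact: sqr_ge0).
    rewrite integral_indic// setIT; apply: leeD => //.
    by rewrite lee_wpmul2l// lee_fin.
have := le_trans fm H.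
have -> : P A = (fine (P A))%:E by rewrite fineK// fin_num_measure.
rewrite -!EFinM -!EFinD !lee_fin => H'.
(* The second moment contributes [(t / 2) C m^2 = m / 4], so [m <= m / 2 + m / 4 + C m P(A)]. *)
rewrite -(@ler_pM2l _ (C * m)) ?mulr_gt0//.
rewrite (_ : C * m * (4 * C)^-1 = m / 4); last by field; rewrite gt_eqF.
have : t / 2 * (C * m ^+ 2) = m / 4 by rewrite /t; field; rewrite !gt_eqF.
by lra.
Qed.

(** * The standard normal law *)

Section StandardNormal.
Context (R : realType).
Local Notation mu := (@lebesgue_measure R).
Local Notation N := (@normal_prob R 0 1).

(** Lebesgue measure is determined by its values on half-open intervals, and the reflected interval,
    closed at the other end, has the same length. *)
Lemma lebesgue_measure_opp (A : set (measurableTypeR R)) : measurable A ->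
  mu (-%R @^-1` A) = mu A.
Proof.
have mopp : measurable_fun setT (-%R : measurableTypeR R -> measurableTypeR R).
  exact: oppr_measurable.
pose opp : {mfun (measurableTypeR R) >-> (measurableTypeR R)} :=
  HB.pack (-%R : R -> R) (isMeasurableFun.Build _ _ _ _ _ mopp).
move=> mA; apply/esym.
apply: (@lebesgue_measure_unique R (pushforward mu opp)) => // _ [[a b] _ <-].
change (mu `]a, b]%classic = mu (-%R @^-1` `]a, b]%classic)).
rewrite (_ : -%R @^-1` _ = `[- b, - a[%classic); last first.
  by apply/seteqP; split => x /=; rewrite !in_itv/= lerNl ltrNr andbC.
by rewrite !lebesgue_measure_itv/= !lte_fin ltrN2 opprK -EFinD addrC.
Qed.

Lemma normal_prob_opp (A : set (measurableTypeR R)) : measurable A ->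
  N (-%R @^-1` A) = N A.
Proof.
move=> mA; rewrite /normal_prob.
have mopp : measurable_fun setT (-%R : measurableTypeR R -> measurableTypeR R).
  exact: oppr_measurable.
transitivity (\int[pushforward mu (-%R : measurableTypeR R -> measurableTypeR R)]_(x in A)
    (normal_pdf 0 1 x)%:E)%E.
  rewrite ge0_integral_pushforward//.
  - apply: eq_integral => x _ /=; congr (_%:E).
    by rewrite !normal_pdfE// /normal_fun !subr0 sqrrN.
  - apply/measurable_EFinP/measurable_funTS; exact: measurable_normal_pdf.
  - by move=> x _; rewrite lee_fin normal_pdf_ge0.
by apply: eq_measure_integral => B mB _; exact: lebesgue_measure_opp.
Qed.

(** The Radon-Nikodym derivative of the normal law and [normal_pdf] have the same integral over
    every measurable set, hence agree almost everywhere. *)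
Lemma integral_normal_prob (f : R -> \bar R) : measurable_fun setT f ->
  (forall x, 0 <= f x)%E ->
  (\int[N]_x f x = \int[mu]_x (f x * (normal_pdf 0 1 x)%:E))%E.
Proof.
move=> mf f0; have dom := @normal_prob_dominates R 0 1.
rewrite -(Radon_Nikodym_SigmaFinite.change_of_variables dom)//.
apply: ae_eq_integral => //.
- apply: emeasurable_funM => //; apply: (measurable_int mu).
  exact: Radon_Nikodym_SigmaFinite.f_integrable.
- apply: emeasurable_funM => //; apply/measurable_EFinP.
  exact: measurable_normal_pdf.
- apply: ae_eqe_mul2l; apply: integral_ae_eq => //.
  + exact: Radon_Nikodym_SigmaFinite.f_integrable.
  + by apply/measurable_EFinP; exact: measurable_normal_pdf.
  + by move=> A _ mA; rewrite -Radon_Nikodym_SigmaFinite.f_integral.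
Qed.

(** Squaring [x^2 / 8 <= exp (x^2 / 8)] gives [x^4 <= 64 exp (x^2 / 4)]. *)
Lemma pow4_exp_le (x : R) :
  x ^+ 4 * expR (- x ^+ 2 / 2) <= 64 * expR (- x ^+ 2 / 4).
Proof.
have -> : - x ^+ 2 / 4 = x ^+ 2 / 4 - x ^+ 2 / 2 by field.
rewrite expRD mulNr mulrA ler_wpM2r ?expR_ge0//.
have -> : x ^+ 2 / 4 = x ^+ 2 / 8 + x ^+ 2 / 8 by field.
rewrite expRD; have := expR_ge1Dx (x ^+ 2 / 8).
set E := expR _ => hE; have := sqr_ge0 x => x20.
have : (x ^+ 2 / 8) ^+ 2 <= E * E by rewrite expr2 ler_pM//; lra.
by rewrite expr_div_n -exprM; lra.
Qed.

Lemma normal_moment4_lty : (\int[N]_x (x ^+ 4)%:E < +oo)%E.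
Proof.
have s2 : Num.sqrt 2 != 0 :> R by rewrite sqrtr_eq0 -ltNge.
have pow4_ge0 (y : R) : 0 <= y ^+ 4 by rewrite (exprM y 2 2) sqr_ge0.
rewrite integral_normal_prob//; last by apply/measurable_EFinP; exact: measurable_funX.
(* The exponent [- x^2 / 4] is that of a centred normal density of variance 2; [k] is 64 times the
   ratio of the normalising constants. *)
pose k : R := normal_peak 1 * 64 / normal_peak (Num.sqrt 2).
have k0 : 0 <= k.
  by rewrite /k divr_ge0 ?normal_peak_ge0// mulr_ge0 ?normal_peak_ge0.
apply: (@le_lt_trans _ _ (\int[mu]_x (k * normal_pdf 0 (Num.sqrt 2) x)%:E)%E).
  apply: ge0_le_integral => //.
  - by move=> x _; rewrite mule_ge0// lee_fin ?normal_pdf_ge0.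
  - apply: emeasurable_funM; apply/measurable_EFinP.
      exact: measurable_funX.
    exact: measurable_normal_pdf.
  - apply/measurable_EFinP/measurable_funM => //; exact: measurable_normal_pdf.
  - move=> x _; rewrite -EFinM lee_fin !normal_pdfE// /normal_fun !subr0.
    rewrite sqr_sqrtr// expr1n -[1 *+ 2]/(2 : R) -[2 *+ 2]/(2 + 2 : R).
    have -> : 2 + 2 = 4 :> R by ring.
    have p2 : 0 < normal_peak (Num.sqrt 2 : R) by exact: normal_peak_gt0.
    rewrite mulrCA /k.
    rewrite (_ : _ / _ * _ = normal_peak 1 * (64 * expR (- x ^+ 2 / 4))); last first.
      by field; rewrite gt_eqF.
    by rewrite ler_wpM2l ?normal_peak_ge0// pow4_exp_le.
under eq_integral do rewrite EFinM.
rewrite ge0_integralZl_EFin//.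
- by rewrite integral_normal_pdf mule1 ltry.
- by move=> x _; rewrite lee_fin normal_pdf_ge0.
- by apply/measurable_EFinP; exact: measurable_normal_pdf.
Qed.

(** If the moment were 0, [x^k] would vanish almost everywhere; it can vanish only at 0, and a point
    is null for the normal law. *)
Lemma normal_even_moment_gt0 k : ~~ odd k -> (0 < \int[N]_x (x ^+ k)%:E)%E.
Proof.
move=> evenk; have xk0 (x : R) : 0 <= x ^+ k by exact: exprn_even_ge0.
rewrite lt_def integral_ge0 ?andbT; last by move=> x _; rewrite lee_fin.
apply/eqP => mk0.
have mk : measurable_fun setT (fun x : measurableTypeR R => (x ^+ k)%:E).
  by apply/measurable_EFinP; exact: measurable_funX.
have /ae_eq_integral_abs : (\int[N]_x `|(x ^+ k)%:E| = 0)%E.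
  by rewrite -[RHS]mk0; apply: eq_integral => x _; rewrite gee0_abs ?lee_fin.
move=> /(_ measurableT mk) [A [mA NA0 subA]].
have N0 : N [set 0] = 0%E.
  have /null_content_dominatesP := @normal_prob_dominates R 0 1; apply => //.
  exact: lebesgue_measure_set1.
have : (N setT <= N (A `|` [set 0%R]))%E.
  apply: le_measure; rewrite ?inE//; first by apply: measurableU.
  move=> x _; have [->|x0] := eqVneq x 0; [by right|left].
  apply: subA => /= /(_ I)[] /eqP.
  by rewrite expf_eq0 (negbTE x0) andbF.
rewrite probability_setT leNgt => /negP; apply.
apply: (@le_lt_trans _ _ (N A + N [set 0%R])%E); first exact: measureU2.
by rewrite NA0 N0 adde0 lte_fin.
Qed.

Lemma normal_moment2_lty : (\int[N]_x (x ^+ 2)%:E < +oo)%E.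
Proof.
have m k : measurable_fun setT (fun x : measurableTypeR R => (x ^+ k)%:E).
  by apply/measurable_EFinP; exact: measurable_funX.
apply: (@le_lt_trans _ _ (\int[N]_x (1 + (x ^+ 4)%:E))%E).
  apply: ge0_le_integral => //.
  - by move=> x _; rewrite lee_fin sqr_ge0.
  - exact: emeasurable_funD.
  - move=> x _; rewrite -EFinD lee_fin (exprM x 2 2).
    by have := sqr_ge0 (x ^+ 2 - 1); have := sqr_ge0 (x ^+ 2); nra.
rewrite ge0_integralD//.
- rewrite integral_cst//= probability_setT mule1 lte_add_pinfty// ?ltry//.
  exact: normal_moment4_lty.
- by move=> x _; rewrite lee_fin (exprM x 2 2) sqr_ge0.
Qed.

End StandardNormal.

(** * Joint law of independent standard normals *)

Section CoordinateSpace.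
Context (R : realType) (I : finType).

Definition box (B : I -> set R) : set (I -> R) :=
  [set x | forall i, B i (x i)].

Definition boxes : set (set (I -> R)) :=
  [set box B | B in [set B | forall i, measurable (B i)]].

(** The product sigma-algebra on finitely many real coordinates. Its generators are stable under
    intersection, so a probability is determined by its values on boxes. *)
Definition coords := g_sigma_algebraType boxes.

(** Used in two ways: [s] selects a single noise coordinate, or all coordinates [v] at once. *)
Definition flip (s : pred I) (x : coords) : coords :=
  fun i => if s i then - x i else x i.

Lemma measurable_box B : (forall i, measurable (B i)) ->
  measurable (box B : set coords).
Proof. by move=> mB; apply: sub_sigma_algebra; exists B. Qed.

Lemma measurable_coord k : measurable_fun setT (fun x : coords => x k).
Proof.
move=> _ A mA; rewrite setTI.
rewrite (_ : _ @^-1` _ = box (fun i => if i == k then A else setT)).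
  by apply: measurable_box => i; case: ifP.
apply/seteqP; split => x /= => [xA i|/(_ k)]; last by rewrite eqxx.
by case: eqP => [->|].
Qed.

Lemma boxesI : setI_closed boxes.
Proof.
move=> _ _ [B mB <-] [C mC <-]; exists (fun i => B i `&` C i).
  by move=> i; exact: measurableI.
apply/seteqP; split => x /=; last by move=> [xB xC] i; split.
by move=> xBC; split => i; case: (xBC i).
Qed.

Lemma boxesT : boxes setT.
Proof.
by exists (fun=> setT) => //; apply/seteqP; split.
Qed.

Lemma flip_box s B : flip s @^-1` box B =
  box (fun i => if s i then -%R @^-1` B i else B i).
Proof.
by apply/seteqP; split => x /= xB i; have := xB i; rewrite /flip; case: ifP.
Qed.

Lemma measurable_flip s : measurable_fun setT (flip s).
Proof.
apply: (@measurability _ _ coords coords _ _ boxes) => // _ [_ [B mB <-] <-].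
rewrite setTI flip_box; apply: measurable_box => i; case: ifP => // _.
by rewrite -[_ @^-1` _]setTI; exact: oppr_measurable.
Qed.

End CoordinateSpace.

(** * The joint law, its sign symmetries and its moments *)

Section JointLaw.
Context (R : realType) (d : measure_display) (T : measurableType d).
Context (P : probability T R) (I : finType) (X : I -> T -> R).
Hypothesis indX : mutually_independent P X.
Hypothesis normX : forall i, std_normal P (X i).
Local Notation N := (@normal_prob R 0 1).

Definition joint (w : T) : coords R I := fun i => X i w.

Lemma joint_box (B : I -> set R) :
  joint @^-1` box B = \bigcap_(i in [set: I]) (X i @^-1` B i).
Proof. by apply/seteqP; split => w /= h i; [move=> _; exact: h|exact: h]. Qed.

Lemma measurable_joint : measurable_fun setT joint.
Proof.
apply: (@measurability _ _ T (coords R I) _ _ (@boxes R I)) => // _ [_ [B mB <-] <-].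
rewrite setTI joint_box; apply: fin_bigcap_measurable => // i _.
by rewrite -[_ @^-1` _]setTI; apply: (indX.1 i).
Qed.

HB.instance Definition _ := isMeasurableFun.Build _ _ _ _ joint measurable_joint.

(** Sign changes are maps of the coordinate space but need not come from maps of [T]; hence the
    passage to the joint law. *)
Definition law : probability (coords R I) R := distribution P joint.

Lemma lawE (A : set (coords R I)) : law A = P (joint @^-1` A).
Proof. by []. Qed.

Lemma law_box B : (forall i, measurable (B i)) ->
  law (box B) = (\prod_i N (B i))%E.
Proof.
move=> mB; rewrite lawE joint_box indX.2//.
by apply: eq_bigr => i _; exact: normX.
Qed.

(** By independence a box has product measure, and each factor is unchanged by reflection. Agreement
    on boxes extends to the whole sigma-algebra. *)
Lemma preserves_flip s : preserves law (flip s).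
Proof.
split; first exact: measurable_flip.
pose F : {mfun (coords R I) >-> (coords R I)} :=
  HB.pack (@flip R I s) (isMeasurableFun.Build _ _ _ _ _ (@measurable_flip R I s)).
move=> A mA.
change (pushforward law F A = law A).
apply: (@measure_unique _ R (coords R I) (@boxes R I) (fun=> setT) _ _ _ _
  (pushforward law F) law) => //.
- exact: boxesI.
- by move=> _; exact: boxesT.
- by rewrite bigcup_const.
- move=> _ [B mB <-]; change (law (flip s @^-1` box B) = law (box B)).
  rewrite flip_box !law_box//.
    apply: eq_bigr => i _; case: ifP => // _; exact: (normal_prob_opp (mB i)).
  move=> i; case: ifP => // _.
  by rewrite -[_ @^-1` _]setTI; exact: oppr_measurable.
- move=> _; change (law (flip s @^-1` setT) < +oo)%E.
  by rewrite preimage_setT probability_setT ltry.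
Qed.

Local Notation E f := (\int[law]_x (f x)%:E)%E.

Lemma law_coord k (f : R -> R) : measurable_fun setT f -> (forall y, 0 <= f y) ->
  E (fun x => f (x k)) = (\int[N]_y (f y)%:E)%E.
Proof.
move=> mf f0.
have mk : measurable_fun setT ((fun x => x k) : coords R I -> measurableTypeR R).
  exact: measurable_coord.
pose F : {mfun (coords R I) >-> (measurableTypeR R)} :=
  HB.pack (fun x : coords R I => x k) (isMeasurableFun.Build _ _ _ _ _ mk).
transitivity (\int[pushforward law F]_y (f y)%:E)%E.
  rewrite [RHS]ge0_integral_pushforward//; first exact/measurable_EFinP.
  by move=> x _; rewrite lee_fin.
apply: eq_measure_integral => A mA _; exact: normX.
Qed.

(** The pair of coordinates has law [N \x N], by uniqueness of the product measure; Tonelli then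
    splits the integral. *)
Lemma law_coord2 k l (f g : R -> R) : k != l ->
  measurable_fun setT f -> (forall y, 0 <= f y) ->
  measurable_fun setT g -> (forall y, 0 <= g y) ->
  E (fun x => f (x k) * g (x l)) =
  (\int[N]_y (f y)%:E * \int[N]_y (g y)%:E)%E.
Proof.
move=> kl mf f0 mg g0.
have mkl : measurable_fun setT
    ((fun x => (x k, x l)) : coords R I -> measurableTypeR R * measurableTypeR R).
  by apply: measurable_fun_pair; exact: measurable_coord.
pose F : {mfun (coords R I) >-> (measurableTypeR R * measurableTypeR R)%type} :=
  HB.pack (fun x : coords R I => (x k, x l)) (isMeasurableFun.Build _ _ _ _ _ mkl).
have mfg : measurable_fun setT (fun y : R * R => (f y.1 * g y.2)%:E).
  apply/measurable_EFinP/measurable_funM; exact: measurableT_comp.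
transitivity (\int[pushforward law F]_y (f y.1 * g y.2)%:E)%E.
  rewrite [RHS]ge0_integral_pushforward//.
  by move=> x _; rewrite lee_fin mulr_ge0.
transitivity (\int[N \x N]_y (f y.1 * g y.2)%:E)%E.
  apply: eq_measure_integral => A mA _; apply/esym.
  apply: product_measure_unique => // B C mB mC.
  change (law ((fun x : coords R I => (x k, x l)) @^-1` (B `*` C)) = N B * N C)%E.
  (* A rectangle in two coordinates is a box whose other sides are the full line, of measure 1. *)
  rewrite (_ : _ @^-1` _ =
      box (fun i => if i == k then B else if i == l then C else setT)).
    rewrite law_box.
      rewrite (bigD1 k)//= (bigD1 l)/=; last by rewrite eq_sym.
      rewrite eqxx eq_sym (negbTE kl) eqxx big1 ?mule1// => i /andP[/negbTE-> /negbTE->].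
      exact: probability_setT.
    by move=> i; case: ifP => // _; case: ifP.
  apply/seteqP; split => x /=.
    by move=> [xB xC] i; case: eqP => [->//|_]; case: eqP => [->//|].
  move=> h; split; first by have := h k; rewrite eqxx.
  by have := h l; rewrite eq_sym (negbTE kl) eqxx.
rewrite fubini_tonelli1//; last by move=> y; rewrite lee_fin mulr_ge0.
rewrite /fubini_F/=.
have mf' : measurable_fun setT (EFin \o f) by exact/measurable_EFinP.
have mg' : measurable_fun setT (EFin \o g) by exact/measurable_EFinP.
under eq_integral => y _.
  under eq_integral do rewrite EFinM.
  rewrite ge0_integralZl_EFin//; last by move=> x _; rewrite lee_fin.
  over.
rewrite ge0_integralZr//.
- by move=> y _; rewrite lee_fin.
- by apply: integral_ge0 => y _; rewrite lee_fin.
Qed.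

End JointLaw.

(** * The single component model *)

(** Cauchy-Schwarz against the constant vector 1. *)
Lemma sqr_sum_le (R : realFieldType) (n : nat) (b : 'I_n -> R) :
  (\sum_i b i) ^+ 2 <= n%:R * \sum_i b i ^+ 2.
Proof.
rewrite mulrC; apply: discriminant_le => s t.
have -> : n%:R = \sum_(i < n) (1 : R) by rewrite sumr_const card_ord.
rewrite !mulr_sumr -!big_split/= sumr_ge0// => i _.
by rewrite mulr1 -mulrA -exprMn mulrAC -mulrA; have := sqr_ge0 (s * b i + t); nra.
Qed.

Lemma markov_gt (R : realType) (d : measure_display) (T : measurableType d)
    (P : {measure set T -> \bar R}) (f : T -> R) (K : R) :
  measurable_fun setT f -> (forall x, 0 <= f x) -> 0 < K ->
  (K%:E * P [set x | (K < f x)%R] <= \int[P]_x (f x)%:E)%E.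
Proof.
move=> mf f0 K0; set A := [set x | _].
have mA : measurable A.
  rewrite (_ : A = setT `&` f @^-1` `]K, +oo[%classic); first exact: mf.
  by rewrite setTI; apply/seteqP; split => x /=; rewrite in_itv/= andbT.
rewrite -[A in P A]setIT -integral_indic// -expectZ ?(ltW K0)//.
apply: expect_le => //.
- by apply: measurable_funM => //; exact: measurable_indic.
- by move=> x; rewrite mulr_ge0 ?(ltW K0)// indicE.
- move=> x; rewrite indicE; have [xA|_] := boolP (x \in A).
    by rewrite mulr1 ltW//; rewrite inE in xA.
  by rewrite mulr0.
Qed.

Section SingleComponentModel.
Context (R : realType) (n p : nat).
Local Notation I := ('I_n + 'I_n * 'I_p)%type.
Local Notation Omega := (coords R I).
Variables (mu : probability Omega R) (m2 m4 : R).
Hypothesis m2_gt0 : 0 < m2.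
Hypothesis m4_gt0 : 0 < m4.
Hypothesis mu_flip : forall s, preserves mu (@flip R I s).
Local Notation E f := (\int[mu]_x (f x)%:E)%E.
Hypothesis mu_sqr : forall k, E (fun x : Omega => x k ^+ 2) = m2%:E.
Hypothesis mu_sqr2 : forall k l, k != l ->
  E (fun x : Omega => x k ^+ 2 * x l ^+ 2) = (m2 ^+ 2)%:E.
Hypothesis mu_pow42 : forall k l, k != l ->
  E (fun x : Omega => x k ^+ 4 * x l ^+ 4) = (m4 ^+ 2)%:E.
Hypothesis n_gt0 : (0 < n)%N.
Hypothesis p_gt1 : (1 < p)%N.
Variables (e : 'cV[R]_p) (r sigma : R).
Hypothesis e_unit : \sum_j e j 0 ^+ 2 = 1.

Let v (i : 'I_n) (x : Omega) : R := x (inl i).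
Let z (i : 'I_n) (j : 'I_p) (x : Omega) : R := x (inr (i, j)).
Let zeta i (x : Omega) : R := \sum_j e j 0 * z i j x.
(** For [e = rho / |rho|] and [r = |rho|] this is the inner product of the observation [x_i] with
    [e]. *)
Let y i (x : Omega) : R := r * v i x + sigma * zeta i x.
Let W j (x : Omega) : R := \sum_i v i x * z i j x.
Let eW (x : Omega) : R := \sum_j e j 0 * W j x.
(** As [e] is a unit vector, the squared norm of the component of [W] orthogonal to [e]. *)
Let Y (x : Omega) : R := \sum_j W j x ^+ 2 - eW x ^+ 2.

(** The quantity [alpha = e^T S e], in coordinates. *)
Definition cov_proj (x : Omega) : R := n%:R^-1 * \sum_i y i x ^+ 2.
(** Coordinate [j] of [q = S e - alpha e]. The signal is parallel to [e], so
    [x_i - y_i e = sigma (z_i - zeta_i e)]. *)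
Definition cov_resid j (x : Omega) : R :=
  sigma / n%:R * \sum_i y i x * (z i j x - zeta i x * e j 0).

Let mv i : measurable_fun setT (v i). Proof. exact: measurable_coord. Qed.
Let mz i j : measurable_fun setT (z i j). Proof. exact: measurable_coord. Qed.

Let mzeta i : measurable_fun setT (zeta i).
Proof. by apply: measurable_sum => j; exact: measurable_funM. Qed.

Let my i : measurable_fun setT (y i).
Proof. by apply: measurable_funD; exact: measurable_funM. Qed.

Let mW j : measurable_fun setT (W j).
Proof. by apply: measurable_sum => i; exact: measurable_funM. Qed.

Let meW : measurable_fun setT eW.
Proof. by apply: measurable_sum => i; exact: measurable_funM. Qed.

Let mW2 : measurable_fun setT (fun x => \sum_j W j x ^+ 2).
Proof. by apply: measurable_sum => j; exact: measurable_funX. Qed.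

Let mY : measurable_fun setT Y.
Proof. by apply: measurable_funB => //; exact: measurable_funX. Qed.

Lemma measurable_cov_proj : measurable_fun setT cov_proj.
Proof.
apply: measurable_funM => //; apply: measurable_sum => i.
exact: measurable_funX.
Qed.

Lemma measurable_cov_resid :
  measurable_fun setT (fun x => \sum_j cov_resid j x ^+ 2).
Proof.
apply: measurable_sum => j; apply: measurable_funX.
apply: measurable_funM => //; apply: measurable_sum => i.
apply: measurable_funM => //; apply: measurable_funB => //.
exact: measurable_funM.
Qed.

Let zflip (k : 'I_n * 'I_p) : Omega -> Omega := flip (pred1 (inr k)).

Let z_zflip k i j x :
  z i j (zflip k x) = if k == (i, j) then - z i j x else z i j x.
Proof.
rewrite /z /zflip /flip /= eq_sym.
by rewrite (_ : (inr k == inr (i, j) :> I) = (k == (i, j))).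
Qed.

(** A linear form in distinct noise coordinates, with coefficients insensitive to noise flips, is a
    sign-symmetric sum. It is applied to [W j], [eW] and [zeta i]. *)
Let expect_linear_z (K : finType) (c : K -> Omega -> R) (h : K -> 'I_n * 'I_p) :
  injective h -> (forall k, measurable_fun setT (c k)) ->
  (forall k l x, c k (zflip l x) = c k x) ->
  let a k x := c k x * z (h k).1 (h k).2 x in
  E (fun x => (\sum_k a k x) ^+ 2) = (\sum_k E (fun x => a k x ^+ 2))%E /\
  (E (fun x => (\sum_k a k x) ^+ 4) <=
    3%:E * E (fun x => (\sum_k a k x ^+ 2) ^+ 2))%E.
Proof.
move=> injh mc cz a.
have ma k : measurable_fun setT (a k) by exact: measurable_funM.
have flip_a k x : a k (zflip (h k) x) = - a k x.
  by rewrite /a cz z_zflip -surjective_pairing eqxx mulrN.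
have fix_a k l x : k != l -> a l (zflip (h k) x) = a l x.
  move=> kl; rewrite /a cz z_zflip -surjective_pairing.
  by rewrite (negbTE (_ : h k != h l)) ?(inj_eq injh).
have pf k : preserves mu (zflip (h k)) by exact: mu_flip.
split; last exact: (expect_pow4_sum pf ma flip_a fix_a) (index_enum_uniq _).
have := expect_sqr_sum pf ma flip_a fix_a (index_enum_uniq K)
  (@measurable_cst _ _ _ _ setT (1 : R)) (fun=> ler01) (fun _ _ _ => erefl).
under eq_integral do rewrite mulr1.
move=> ->; under eq_integral do rewrite mulr1.
rewrite expect_sum// => [k|k x]; first exact: measurable_funX.
exact: sqr_ge0.
Qed.

Lemma expect_W2 j : E (fun x => W j x ^+ 2) = (n%:R * m2 ^+ 2)%:E.
Proof.
have inj : injective (fun i : 'I_n => (i, j)) by move=> i i' [].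
have [-> _] := expect_linear_z inj mv (fun i l x => erefl).
rewrite (eq_bigr (fun=> (m2 ^+ 2)%:E)) => [|i _].
  by rewrite sumEFin sumr_const card_ord mulr_natl.
rewrite -(@mu_sqr2 (inl i) (inr (i, j)))//.
by apply: eq_integral => x _; rewrite exprMn.
Qed.

(** The 3 comes from the fourth-moment inequality, one factor [n] from [sqr_sum_le], the other from
    the [n] terms of mean [m4^2]. *)
Lemma expect_W4 j : (E (fun x => W j x ^+ 4) <= (3 * n%:R ^+ 2 * m4 ^+ 2)%:E)%E.
Proof.
have inj : injective (fun i : 'I_n => (i, j)) by move=> i i' [].
have [_ /le_trans] := expect_linear_z inj mv (fun i l x => erefl); apply.
rewrite -mulrA EFinM lee_wpmul2l//=.
have m i : measurable_fun setT (fun x => (v i x * z i j x) ^+ 4).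
  by apply: measurable_funX; exact: measurable_funM.
have pow4_ge0 (t : R) : 0 <= t ^+ 4 by rewrite (exprM t 2 2) sqr_ge0.
apply: (@le_trans _ _ (E (fun x => n%:R * \sum_i (v i x * z i j x) ^+ 4))).
  apply: expect_le.
  - apply/measurable_funX/measurable_sum => i.
    by apply: measurable_funX; exact: measurable_funM.
  - by apply: measurable_funM => //; exact: measurable_sum.
  - by move=> x; exact: sqr_ge0.
  - move=> x; apply: le_trans (sqr_sum_le _) _.
    by rewrite ler_wpM2l// ler_sum// => i _; rewrite -exprM.
rewrite expectZ//; last 2 first.
- exact: measurable_sum.
- by move=> x; rewrite sumr_ge0.
rewrite expect_sum// (eq_bigr (fun=> (m4 ^+ 2)%:E)) => [|i _].
  rewrite sumEFin sumr_const card_ord -EFinM lee_fin.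
  by rewrite -[m4 ^+ 2 *+ n]mulr_natl mulrA -expr2.
rewrite -(@mu_pow42 (inl i) (inr (i, j)))//.
by apply: eq_integral => x _; rewrite exprMn.
Qed.

Lemma eWE x : eW x = \sum_(k : 'I_n * 'I_p) (e k.2 0 * v k.1 x) * z k.1 k.2 x.
Proof.
rewrite /eW -(pair_bigA _ (fun i j => (e j 0 * v i x) * z i j x))/= exchange_big/=.
by apply: eq_bigr => j _; rewrite mulr_sumr; apply: eq_bigr => i _; rewrite mulrA.
Qed.

Lemma expect_eW2 : E (fun x => eW x ^+ 2) = (n%:R * m2 ^+ 2)%:E.
Proof.
under eq_integral do rewrite eWE.
have mc (k : 'I_n * 'I_p) : measurable_fun setT (fun x => e k.2 0 * v k.1 x).
  exact: measurable_funM.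
have [-> _] := expect_linear_z (@inj_id _) mc (fun k l x => erefl).
rewrite (eq_bigr (fun k => (e k.2 0 ^+ 2 * m2 ^+ 2)%:E)) => [|k _]; last first.
  rewrite EFinM -(@mu_sqr2 (inl k.1) (inr k))// -expectZ ?sqr_ge0//.
  - by apply: eq_integral => x _; rewrite /z /v !exprMn -mulrA -surjective_pairing.
  - by apply: measurable_funM; apply: measurable_funX; exact: measurable_coord.
  - by move=> x; rewrite mulr_ge0 ?sqr_ge0.
rewrite sumEFin -mulr_suml -(pair_bigA _ (fun i j => e j 0 ^+ 2))/=.
by rewrite e_unit sumr_const card_ord.
Qed.

Lemma expect_sumW2 : E (fun x => \sum_j W j x ^+ 2) = ((n * p)%:R * m2 ^+ 2)%:E.
Proof.
rewrite expect_sum => [|j|j x]; last 2 first.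
- exact: measurable_funX.
- exact: sqr_ge0.
under eq_bigr do rewrite expect_W2.
by rewrite sumEFin sumr_const card_ord -[_ *+ p]mulr_natr natrM mulrAC.
Qed.

Lemma expect_sumW2_sqr :
  (E (fun x => (\sum_j W j x ^+ 2) ^+ 2) <= (3 * (n * p)%:R ^+ 2 * m4 ^+ 2)%:E)%E.
Proof.
have pow4_ge0 (t : R) : 0 <= t ^+ 4 by rewrite (exprM t 2 2) sqr_ge0.
have m j : measurable_fun setT (fun x => W j x ^+ 4) by exact: measurable_funX.
apply: (@le_trans _ _ (E (fun x => p%:R * \sum_j W j x ^+ 4))).
  apply: expect_le.
  - exact: measurable_funX.
  - by apply: measurable_funM => //; exact: measurable_sum.
  - by move=> x; exact: sqr_ge0.
  - move=> x; apply: le_trans (sqr_sum_le _) _.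
    by rewrite ler_wpM2l// ler_sum// => i _; rewrite -exprM.
rewrite expectZ//; last 2 first.
- exact: measurable_sum.
- by move=> x; rewrite sumr_ge0.
rewrite expect_sum//.
apply: (@le_trans _ _ (p%:R%:E * \sum_(j < p) (3 * n%:R ^+ 2 * m4 ^+ 2)%:E)%E).
  by rewrite lee_wpmul2l ?lee_fin// lee_sum// => j _; exact: expect_W4.
rewrite sumEFin sumr_const card_ord -EFinM lee_fin -[_ *+ p]mulr_natr natrM.
by rewrite le_eqVlt; apply/orP; left; apply/eqP; ring.
Qed.

Let Y_ge0 x : 0 <= Y x.
Proof.
rewrite subr_ge0; have := vdot_sqr_le e (\col_j W j x).
have -> : vdot e e = 1.
  by rewrite -e_unit; apply: eq_bigr => j _; rewrite expr2.
rewrite mul1r /vdot /eW.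
under eq_bigr do rewrite mxE; move=> /le_trans; apply.
by under eq_bigr do rewrite mxE -expr2.
Qed.

(** Chosen so that [C m^2 = 3 (n p)^2 m4^2] for [m = n p m2^2 / 2]; it is independent of [n] and
    [p]. *)
Let C : R := 12 * m4 ^+ 2 / m2 ^+ 4.

(** Paley-Zygmund for [Y], whose mean is [(n p - n) m2^2] and whose second moment is at most that of
    [|W|^2]. *)
Let Y_large :
  ((4 * C)^-1%:E <= mu [set x | ((n * p)%:R * m2 ^+ 2 / 2 / 2 <= Y x)%R])%E.
Proof.
have n0 : 0 < n%:R :> R by rewrite ltr0n.
have p0 : 0 < p%:R :> R by rewrite ltr0n ltnW.
have p2 : 2 <= p%:R :> R by rewrite ler_nat.
apply: paley_zygmund => //.
- by rewrite divr_gt0// mulr_gt0 ?exprn_gt0// natrM mulr_gt0.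
- by rewrite divr_gt0 ?exprn_gt0// mulr_gt0 ?exprn_gt0.
- have EY : (E Y + (n%:R * m2 ^+ 2)%:E = ((n * p)%:R * m2 ^+ 2)%:E)%E.
    rewrite -expect_eW2 -expectD//; last 2 first.
    + exact: measurable_funX.
    + by move=> x; exact: sqr_ge0.
    by rewrite -expect_sumW2; apply: eq_integral => x _; rewrite subrK.
  have fY : E Y \is a fin_num.
    by move: EY; case: (E Y).
  rewrite -(fineK fY); move: EY; rewrite -(fineK fY) -EFinD => -[EY].
  rewrite lee_fin.
  (* Here [p >= 2] enters: removing the direction [e] costs at most half of the mean. *)
  have : n%:R * m2 ^+ 2 <= (n * p)%:R * m2 ^+ 2 / 2.
    rewrite natrM ler_pdivlMr// mulrAC ler_wpM2r ?sqr_ge0//.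
    by rewrite ler_wpM2l// ltW.
  by move: EY => /=; lra.
- apply: le_trans (le_trans _ expect_sumW2_sqr) _.
    apply: expect_le.
    + exact: measurable_funX.
    + exact: measurable_funX.
    + by move=> x; exact: sqr_ge0.
    + move=> x; rewrite ler_pXn2r ?nnegrE ?Y_ge0//.
        by rewrite gerBl sqr_ge0.
      by apply: sumr_ge0 => j _; exact: sqr_ge0.
  rewrite lee_fin le_eqVlt; apply/orP; left; apply/eqP.
  by rewrite /C; field; rewrite gt_eqF.
Qed.

(** The bound [y^2 <= 2 r^2 v^2 + 2 sigma^2 zeta^2] avoids the cross term, and [zeta] has second
    moment [m2] because [e] is a unit vector. *)
Lemma expect_cov_proj :
  (E cov_proj <= ((2 * r ^+ 2 + 2 * sigma ^+ 2) * m2)%:E)%E.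
Proof.
have mv2 i : measurable_fun setT (fun x => v i x ^+ 2) by exact: measurable_funX.
have mz2 i : measurable_fun setT (fun x => zeta i x ^+ 2) by exact: measurable_funX.
have Ezeta i : E (fun x => zeta i x ^+ 2) = m2%:E.
  have inj : injective (fun j : 'I_p => (i, j)) by move=> j j' [].
  have [-> _] := expect_linear_z inj
    (fun j => @measurable_cst _ _ _ _ setT (e j 0)) (fun j l x => erefl).
  rewrite (eq_bigr (fun j => (e j 0 ^+ 2 * m2)%:E)) => [|j _].
    by rewrite sumEFin -mulr_suml e_unit mul1r.
  rewrite EFinM -(mu_sqr (inr (i, j))) -expectZ ?sqr_ge0//.
  - by apply: eq_integral => x _; rewrite exprMn.
  - by apply: measurable_funX; exact: measurable_coord.
  - by move=> x; exact: sqr_ge0.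
have Ey i : (E (fun x => y i x ^+ 2) <= ((2 * r ^+ 2 + 2 * sigma ^+ 2) * m2)%:E)%E.
  apply: (@le_trans _ _ (E (fun x => 2 * r ^+ 2 * v i x ^+ 2 +
      2 * sigma ^+ 2 * zeta i x ^+ 2))).
    apply: expect_le.
    - exact: measurable_funX.
    - by apply: measurable_funD; exact: measurable_funM.
    - by move=> x; exact: sqr_ge0.
    - move=> x; rewrite /y.
      by have := sqr_ge0 (r * v i x - sigma * zeta i x); nra.
  have r20 : 0 <= 2 * r ^+ 2 by rewrite mulr_ge0// sqr_ge0.
  have s20 : 0 <= 2 * sigma ^+ 2 by rewrite mulr_ge0// sqr_ge0.
  rewrite expectD.
  - have v0 x : 0 <= v i x ^+ 2 by exact: sqr_ge0.
    have z0 x : 0 <= zeta i x ^+ 2 by exact: sqr_ge0.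
    rewrite !expectZ//.
    by rewrite Ezeta (mu_sqr (inl i)) -!EFinM -EFinD lee_fin; lra.
  - exact: measurable_funM.
  - by move=> x; rewrite mulr_ge0// sqr_ge0.
  - exact: measurable_funM.
  - by move=> x; rewrite mulr_ge0// sqr_ge0.
have n0 : 0 < n%:R :> R by rewrite ltr0n.
rewrite /cov_proj expectZ ?invr_ge0//; last 2 first.
- by apply: measurable_sum => i; exact: measurable_funX.
- by move=> x; apply: sumr_ge0 => i _; exact: sqr_ge0.
rewrite expect_sum; last 2 first.
- by move=> i; exact: measurable_funX.
- by move=> i x; exact: sqr_ge0.
set M := (_ * m2).
apply: (@le_trans _ _ (n%:R^-1%:E * \sum_(i < n) M%:E)%E).
  by rewrite lee_wpmul2l ?lee_fin ?invr_ge0// lee_sum.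
rewrite sumEFin sumr_const card_ord -EFinM lee_fin -[M *+ n]mulr_natl mulrA.
by rewrite mulVf ?mul1r// gt_eqF.
Qed.

Let vflip : Omega -> Omega := flip (fun k => if k is inl _ then true else false).

(* The part of the residual that is odd in [v] survives the comparison of [x]
   with [vflip x]. *)
Let resid_vflip x : 2 * ((sigma * r / n%:R) ^+ 2 * Y x) <=
  \sum_j cov_resid j x ^+ 2 + \sum_j cov_resid j (vflip x) ^+ 2.
Proof.
(* The terms [sigma zeta_i] of [y_i] are even in [v] and cancel, leaving twice the odd part. *)
have dE j : cov_resid j x - cov_resid j (vflip x) =
    2 * (sigma * r / n%:R) * (W j x - e j 0 * eW x).
  have -> : eW x = \sum_i v i x * zeta i x.
    rewrite /eW /W /zeta; under eq_bigr do rewrite mulr_sumr.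
    rewrite exchange_big/=; apply: eq_bigr => i _; rewrite mulr_sumr.
    by apply: eq_bigr => k _; rewrite mulrCA.
  rewrite /cov_resid /W -mulrBr -sumrB mulr_sumr -sumrB.
  rewrite [in RHS]mulr_sumr [in LHS]mulr_sumr; apply: eq_bigr => i _.
  have -> : zeta i (vflip x) = zeta i x by [].
  have -> : z i j (vflip x) = z i j x by [].
  have -> : y i (vflip x) = - (r * v i x) + sigma * zeta i x.
    by rewrite /y -mulrN.
  by rewrite /y; ring.
have YE : \sum_j (W j x - e j 0 * eW x) ^+ 2 = Y x.
  transitivity (\sum_j (W j x ^+ 2 + (- (2 * eW x) * (e j 0 * W j x) +
      eW x ^+ 2 * e j 0 ^+ 2))).
    by apply: eq_bigr => j _; ring.
  by rewrite !big_split/= -!mulr_sumr e_unit -/(eW x) /Y; ring.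
have : \sum_j (cov_resid j x - cov_resid j (vflip x)) ^+ 2 =
    4 * ((sigma * r / n%:R) ^+ 2 * Y x).
  rewrite -YE !mulr_sumr; apply: eq_bigr => j _; rewrite dE.
  by ring.
have : \sum_j (cov_resid j x - cov_resid j (vflip x)) ^+ 2 <=
    2 * (\sum_j cov_resid j x ^+ 2 + \sum_j cov_resid j (vflip x) ^+ 2).
  rewrite -big_split mulr_sumr; apply: ler_sum => j _ /=.
  by have := sqr_ge0 (cov_resid j x + cov_resid j (vflip x)); nra.
by lra.
Qed.

(** A large residual has probability at least [1 / (8 C)], and Markov's inequality bounds the loss
    from [alpha > K]. The threshold depends on the dimensions only through [p / n]. *)
Lemma good_event_prob (K : R) : 0 < K ->
  (((8 * C)^-1 - (2 * r ^+ 2 + 2 * sigma ^+ 2) * m2 / K)%:E <=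
   mu [set x | (cov_proj x <= K)%R /\
     ((sigma * r) ^+ 2 * (p%:R / n%:R) * m2 ^+ 2 / 4 <=
      \sum_j cov_resid j x ^+ 2)%R])%E.
Proof.
move=> K0; set t := (_ / 4); set G := [set x | _].
pose Q := [set x | (t <= \sum_j cov_resid j x ^+ 2)%R].
pose B := [set x | (K < cov_proj x)%R].
have mQ : measurable Q.
  rewrite (_ : Q = setT `&` (fun x => \sum_j cov_resid j x ^+ 2) @^-1`
    `[t, +oo[%classic); first exact: measurable_cov_resid.
  by rewrite setTI; apply/seteqP; split => x /=; rewrite in_itv/= andbT.
have mB : measurable B.
  rewrite (_ : B = setT `&` cov_proj @^-1` `]K, +oo[%classic).
    exact: measurable_cov_proj.
  by rewrite setTI; apply/seteqP; split => x /=; rewrite in_itv/= andbT.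
have GE : G = Q `\` B.
  apply/seteqP; split => x /= [h1 h2]; split => //.
    by apply/negP; rewrite -leNgt.
  by rewrite leNgt; apply/negP.
have mG : measurable G by rewrite GE; exact: measurableD.
have n0 : 0 < n%:R :> R by rewrite ltr0n.
have p0 : 0 < p%:R :> R by rewrite ltr0n ltnW.
have [mvf pvf] := mu_flip (fun k => if k is inl _ then true else false).
have mvQ : measurable (vflip @^-1` Q) by rewrite -[_ @^-1` _]setTI; exact: mvf.
(* Where [Y] is large, [x] or [vflip x] lies in [Q]; the two events have equal probability. *)
have YQ : ((4 * C)^-1%:E <= mu Q + mu Q)%E.
  apply: le_trans Y_large _; rewrite -{2}(pvf _ mQ).
  apply: le_trans (measureU2 mu mQ mvQ).
  apply: le_measure; rewrite ?inE; last first.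
  - move=> x /= Yx; have := resid_vflip x.
    have tY : t <= (sigma * r / n%:R) ^+ 2 * Y x.
      apply: (@le_trans _ _ ((sigma * r / n%:R) ^+ 2 * ((n * p)%:R * m2 ^+ 2 / 2 / 2))).
        rewrite le_eqVlt; apply/orP; left; apply/eqP.
        by rewrite /t natrM; field; rewrite gt_eqF.
      by rewrite ler_wpM2l ?sqr_ge0.
    have [tx _|tx] := leP t (\sum_j cov_resid j x ^+ 2); first by left.
    by move=> h; right; rewrite /Q /=; lra.
  - exact: measurableU.
  - rewrite (_ : [set x | _] = setT `&` Y @^-1`
        `[(n * p)%:R * m2 ^+ 2 / 2 / 2, +oo[%classic); first exact: mY.
    by rewrite setTI; apply/seteqP; split => x /=; rewrite in_itv/= andbT.
have BK : (K%:E * mu B <= ((2 * r ^+ 2 + 2 * sigma ^+ 2) * m2)%:E)%E.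
  apply: le_trans expect_cov_proj; apply: markov_gt => //.
    exact: measurable_cov_proj.
  move=> x; rewrite mulr_ge0 ?invr_ge0 ?(ltW n0)//.
  by apply: sumr_ge0 => i _; exact: sqr_ge0.
have QGB : (mu Q <= mu G + mu B)%E.
  apply: le_trans (measureU2 mu mG mB); apply: le_measure; rewrite ?inE//.
    exact: measurableU.
  move=> x Qx; have [Bx|Bx] := pselect (B x); [by right|left].
  by rewrite GE.
have fA A : measurable A -> mu A = (fine (mu A))%:E.
  by move=> mA; rewrite fineK// fin_num_measure.
move: YQ BK QGB; rewrite (fA G)// (fA B)// (fA Q)// -!EFinD -!EFinM !lee_fin.
move=> YQ; rewrite mulrC -ler_pdivlMr// => BK QGB.
have C0 : 0 < C by rewrite divr_gt0 ?exprn_gt0// mulr_gt0 ?exprn_gt0.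
have -> : (8 * C)^-1 = (4 * C)^-1 / 2 by field; rewrite gt_eqF.
by lra.
Qed.

End SingleComponentModel.

(** The integral of a nonnegative function is a supremum over simple functions below it, so
    enlarging the function enlarges the index set. *)
Lemma ge0_le_integral_nomeas (R : realType) (d : measure_display)
    (T : measurableType d) (mu : {measure set T -> \bar R}) (f g : T -> \bar R) :
  (forall x, 0 <= f x)%E -> (forall x, f x <= g x)%E ->
  (\int[mu]_x f x <= \int[mu]_x g x)%E.
Proof.
move=> f0 fg; rewrite !ge0_integralTE// => [|x]; last exact: le_trans (f0 x) (fg x).
apply: le_ereal_sup => _ [h hf <-]; exists h => // x.
exact: le_trans (hf x) (fg x).
Qed.

Lemma limn_einf_ge (R : realType) (u : (\bar R)^nat) (l : \bar R) :
  (\forall n \near \oo, (l <= u n)%E) -> (l <= limn_einf u)%E.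
Proof.
move=> [N _ lu]; rewrite limn_einf_lim; apply: lime_ge; first exact: is_cvg_einfs.
exists N => // n /= Nn; apply: le_ereal_inf_tmp => _ [k /= nk <-].
by apply: lu => /=; exact: leq_trans nk.
Qed.

Lemma normalized_unit (R : realType) (p : nat) (rho : 'cV[R]_p) :
  0 < vnorm rho -> \sum_j ((vnorm rho)^-1 *: rho) j 0 ^+ 2 = 1.
Proof.
move=> rho_gt0; under eq_bigr do rewrite mxE exprMn.
rewrite -mulr_sumr (_ : \sum_j _ = vnorm rho ^+ 2).
  by rewrite exprVn mulVf// expf_neq0// gt_eqF.
by rewrite sqr_vnorm; apply: eq_bigr => j _; rewrite expr2.
Qed.

(** * The coordinate formulas read on the actual sample covariance *)

Section SampleCovarianceOfModel.
Context (R : realType) (n p : nat) (rho : 'cV[R]_p) (sigma : R).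
Context (x : coords R ('I_n + 'I_n * 'I_p)%type).
Hypothesis rho_gt0 : 0 < vnorm rho.
Let r := vnorm rho.
Let e := r^-1 *: rho.
Let data (i : 'I_n) : 'cV[R]_p :=
  \col_j (x (inl i) * rho j 0 + sigma * x (inr (i, j))).
Local Notation S := (sample_cov data).

Let rhoE j : rho j 0 = r * e j 0.
Proof. by rewrite mxE mulrA mulfV ?mul1r// gt_eqF. Qed.

Let data_e i : vdot (data i) e =
  r * x (inl i) + sigma * \sum_j e j 0 * x (inr (i, j)).
Proof.
(* Writing 1 as [|e|^2] turns both sides into sums over coordinates that match term by term. *)
rewrite -[r]mulr1 -(normalized_unit rho_gt0) mulrAC !mulr_sumr -big_split/=.
apply: eq_bigr => j _; rewrite mxE rhoE.
by ring.
Qed.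

Lemma cov_projE : vdot e (S *m e) = cov_proj e r sigma x.
Proof.
rewrite vdot_sample_cov; congr (_ * _).
by apply: eq_bigr => i _; rewrite data_e expr2.
Qed.

Lemma cov_residE j :
  (S *m e - vdot e (S *m e) *: e) j 0 = cov_resid e r sigma j x.
Proof.
have entryB (f g : 'cV[R]_p) (k : R) : (f - k *: g) j 0 = f j 0 - k * g j 0.
  by rewrite !mxE.
rewrite entryB cov_projE -vdot_delta vdot_sample_cov /cov_proj /cov_resid.
rewrite -[_ * _ * e j 0]mulrA -mulrBr mulr_suml -sumrB.
rewrite [sigma / _]mulrC -[RHS]mulrA [sigma * _]mulr_sumr; congr (_ * _).
apply: eq_bigr => i _.
by rewrite data_e (vdotC (data i)) vdot_delta mxE rhoE; ring.
Qed.

End SampleCovarianceOfModel.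

(** * Lower bound for the mean angle at a fixed sample size *)

Section FixedSize.
Context (R : realType) (d : measure_display) (T : measurableType d).
Context (P : probability T R) (n p : nat) (rho : 'cV[R]_p) (sigma : R).
Context (v : 'I_n -> T -> R) (z : 'I_n -> 'I_p -> T -> R) (rhohat : T -> 'cV[R]_p).

Lemma vangle_ge0 (f g : 'cV[R]_p) : 0 <= vangle f g.
Proof.
rewrite acos_ge0// (le_trans (_ : -1 <= 0)) ?divr_ge0 ?mulr_ge0 ?vnorm_ge0//=.
(* For a zero vector the quotient is 0 by the convention on division, still in the domain of
   [acos]. *)
have [->|fg] := eqVneq (vnorm f * vnorm g) 0; first by rewrite invr0 mulr0.
rewrite ler_pdivrMr ?mul1r; last by rewrite lt_def fg mulr_ge0 ?vnorm_ge0.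
rewrite -(@ler_pXn2r _ 2) ?nnegrE ?mulr_ge0 ?vnorm_ge0//.
by rewrite real_normK ?num_real// exprMn !sqr_vnorm vdot_sqr_le.
Qed.

(** The angle dominates a constant times the indicator of the good event. The resulting bound is a
    function of [K], [t] and [C] alone, hence uniform in [n] once these are fixed. *)
Lemma vangle_expect_ge (m2 m4 C K t : R) :
  m2%:E = (\int[normal_prob 0 1]_y (y ^+ 2)%:E)%E ->
  m4%:E = (\int[normal_prob 0 1]_y (y ^+ 4)%:E)%E ->
  (0 < n)%N -> (1 < p)%N -> 0 < vnorm rho ->
  mutually_independent P (fun k : 'I_n + 'I_n * 'I_p =>
    match k with inl i => v i | inr ij => z ij.1 ij.2 end) ->
  (forall i, std_normal P (v i)) -> (forall i j, std_normal P (z i j)) ->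
  (forall w, top_unit_eigvec (sample_cov (fun i : 'I_n =>
     \col_(j < p) (v i w * rho j 0 + sigma * z i j w))) (rhohat w)) ->
  C = 12 * m4 ^+ 2 / m2 ^+ 4 -> 0 < K -> 0 < t ->
  (2 * vnorm rho ^+ 2 + 2 * sigma ^+ 2) * m2 / K <= (16 * C)^-1 ->
  t <= (sigma * vnorm rho) ^+ 2 * (p%:R / n%:R) * m2 ^+ 2 / 4 ->
  ((acos (Num.sqrt (K ^+ 2 / (K ^+ 2 + t))) * (16 * C)^-1)%:E <=
   \int[P]_w (vangle (rhohat w) rho)%:E)%E.
Proof.
move=> m2E m4E n0 p1 r0 ind nv nz top CE K0 t0 MK tt.
have pow4_ge0 (y : R) : 0 <= y ^+ 4 by rewrite (exprM y 2 2) sqr_ge0.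
have m2_gt0 : 0 < m2 by rewrite -lte_fin m2E normal_even_moment_gt0.
have m4_gt0 : 0 < m4 by rewrite -lte_fin m4E normal_even_moment_gt0.
set X := (X in mutually_independent P X) in ind.
have nX k : std_normal P (X k) by case: k => [i|[i j]]; [exact: nv|exact: nz].
pose e := (vnorm rho)^-1 *: rho.
have C0 : 0 < C by rewrite CE divr_gt0 ?exprn_gt0// mulr_gt0 ?exprn_gt0.
have law_sqr k : (\int[law ind]_x (x k ^+ 2)%:E)%E = m2%:E.
  rewrite m2E; apply: (law_coord ind nX k (f := fun y => y ^+ 2)).
    exact: measurable_funX.
  by move=> y; exact: sqr_ge0.
have law_sqr2 k l : k != l ->
    (\int[law ind]_x (x k ^+ 2 * x l ^+ 2)%:E)%E = (m2 ^+ 2)%:E.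
  move=> kl; rewrite expr2 EFinM m2E.
  by apply: (law_coord2 ind nX kl (f := fun y => y ^+ 2)
    (g := fun y => y ^+ 2)); try exact: measurable_funX; move=> y; exact: sqr_ge0.
have law_pow42 k l : k != l ->
    (\int[law ind]_x (x k ^+ 4 * x l ^+ 4)%:E)%E = (m4 ^+ 2)%:E.
  move=> kl; rewrite expr2 EFinM m4E.
  by apply: (law_coord2 ind nX kl (f := fun y => y ^+ 4)
    (g := fun y => y ^+ 4)); try exact: measurable_funX.
have := @good_event_prob R n p (law ind) m2 m4 m2_gt0 m4_gt0
  (preserves_flip ind nX) law_sqr law_sqr2 law_pow42 n0 p1 e (vnorm rho) sigma
  (normalized_unit r0) K K0.
set G := [set x | _] => GP.
have {}GP : (((16 * C)^-1)%:E <= P (joint X @^-1` G))%E.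
  apply: le_trans GP.
  (* The Markov loss is at most half of [1 / (8 C)]. *)
  rewrite -CE lee_fin (_ : (8 * C)^-1 = 2 * (16 * C)^-1); first lra.
  by field; rewrite gt_eqF.
have mG : measurable (joint X @^-1` G).
  rewrite -[_ @^-1` _]setTI; apply: (measurable_joint ind) => //.
  rewrite (_ : G = (setT `&` cov_proj e (vnorm rho) sigma @^-1` `]-oo, K]%classic)
    `&` (setT `&` (fun x => \sum_j cov_resid e (vnorm rho) sigma j x ^+ 2) @^-1`
      `[(sigma * vnorm rho) ^+ 2 * (p%:R / n%:R) * m2 ^+ 2 / 4, +oo[%classic)).
    apply: measurableI; first exact: measurable_cov_proj.
    exact: measurable_cov_resid.
  by rewrite !setTI; apply/seteqP; split => x /=; rewrite !in_itv/= andbT.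
set th := acos _.
have th0 : 0 <= th.
  rewrite /th acos_ge0// (le_trans (_ : -1 <= 0)) ?sqrtr_ge0//=.
  rewrite -[leRHS]sqrtr1 ler_sqrt// ler_pdivrMr ?mul1r.
    by rewrite lerDl ltW.
  by rewrite ltr_wpDl ?sqr_ge0.
apply: (@le_trans _ _ (\int[P]_w (th * \1_(joint X @^-1` G) w)%:E)%E).
  rewrite expectZ//; try exact: measurable_indic.
  by rewrite integral_indic// setIT EFinM lee_wpmul2l.
apply: ge0_le_integral_nomeas => w; first by rewrite lee_fin mulr_ge0// indicE.
rewrite lee_fin indicE; have [wG|_] := boolP (w \in _); last first.
  by rewrite mulr0 vangle_ge0.
rewrite mulr1; move: wG; rewrite inE => -[/= proj_le resid_ge].
apply: (vangle_ge r0 (top w)) => //.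
  rewrite (cov_projE sigma (joint X w) r0).
  exact: proj_le.
apply: le_trans tt (le_trans resid_ge _).
rewrite le_eqVlt; apply/orP; left; apply/eqP.
by apply: eq_bigr => j _; rewrite -expr2 -cov_residE.
Qed.

End FixedSize.

Theorem theorem2 (R : realType) (d : measure_display) (T : measurableType d)
    (P : probability T R)
    (p : nat -> nat) (rho : forall n : nat, 'cV[R]_(p n)) (sigma : R)
    (varrho c : R)
    (v : forall n : nat, 'I_n -> T -> R)
    (z : forall n : nat, 'I_n -> 'I_(p n) -> T -> R)
    (rhohat : forall n : nat, T -> 'cV[R]_(p n)) :
  0 < sigma ->
  (forall n, mutually_independent P
     (fun k : 'I_n + 'I_n * 'I_(p n) =>
        match k with inl i => v n i | inr ij => z n ij.1 ij.2 end)) ->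
  (forall n i, std_normal P (v n i)) ->
  (forall n i j, std_normal P (z n i j)) ->
  0 < varrho ->
  (fun n => vnorm (rho n)) @ \oo --> varrho ->
  0 < c ->
  (fun n => (p n)%:R / n%:R : R) @ \oo --> c ->
  (forall n (w : T), (0 < p n)%N ->
     top_unit_eigvec
       (sample_cov (fun i : 'I_n =>
          \col_(j < p n) (v n i w * rho n j 0 + sigma * z n i j w)))
       (rhohat n w)) ->
  (forall n j, measurable_fun setT (fun w => rhohat n w j 0)) ->
  (0 < limn_einf (fun n => \int[P]_w (vangle (rhohat n w) (rho n))%:E))%E.
Proof.
move=> s0 ind nv nz vr0 cvg_rho c0 cvg_p top _.
have pow4_ge0 (y : R) : 0 <= y ^+ 4 by rewrite (exprM y 2 2) sqr_ge0.
pose m2 : R := fine (\int[normal_prob 0 1]_y (y ^+ 2)%:E)%E.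
pose m4 : R := fine (\int[normal_prob 0 1]_y (y ^+ 4)%:E)%E.
have m2E : m2%:E = (\int[normal_prob 0 1]_y (y ^+ 2)%:E)%E.
  rewrite fineK// ge0_fin_numE ?normal_moment2_lty// integral_ge0// => y _.
  by rewrite lee_fin sqr_ge0.
have m4E : m4%:E = (\int[normal_prob 0 1]_y (y ^+ 4)%:E)%E.
  rewrite fineK// ge0_fin_numE ?normal_moment4_lty// integral_ge0// => y _.
  by rewrite lee_fin.
have m2_gt0 : 0 < m2 by rewrite -lte_fin m2E normal_even_moment_gt0.
have m4_gt0 : 0 < m4 by rewrite -lte_fin m4E normal_even_moment_gt0.
pose C := 12 * m4 ^+ 2 / m2 ^+ 4.
have C0 : 0 < C by rewrite divr_gt0 ?exprn_gt0// mulr_gt0 ?exprn_gt0.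
(* Bounds the mean of [alpha] as soon as [|rho| < 2 varrho]; [K] below then makes the Markov loss
   [M / K] equal to [1 / (16 C)]. *)
pose M := (2 * (2 * varrho) ^+ 2 + 2 * sigma ^+ 2) * m2.
have M0 : 0 < M.
  by apply: mulr_gt0 => //; apply: addr_gt0; apply: mulr_gt0 => //;
    apply: exprn_gt0 => //; exact: mulr_gt0.
pose K := 16 * C * M.
have K0 : 0 < K by apply: mulr_gt0 => //; exact: mulr_gt0.
(* The residual threshold with [|rho|] and [p / n] replaced by half of their limits, eventually
   lower bounds. *)
pose t := (sigma * (varrho / 2)) ^+ 2 * (c / 2) * m2 ^+ 2 / 4.
have t0 : 0 < t.
  rewrite divr_gt0// mulr_gt0 ?exprn_gt0// mulr_gt0 ?divr_gt0//.
  by rewrite exprn_gt0// mulr_gt0// divr_gt0.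
pose th := acos (Num.sqrt (K ^+ 2 / (K ^+ 2 + t))).
have th0 : 0 < th.
  rewrite acos_gt0// (le_trans (_ : -1 <= 0)) ?sqrtr_ge0//=.
  rewrite -[ltRHS]sqrtr1 ltr_sqrt// ltr_pdivrMr ?mul1r.
    by rewrite ltrDl.
  by rewrite addr_gt0// exprn_gt0.
apply: (@lt_le_trans _ _ (th * (16 * C)^-1)%:E).
  by rewrite lte_fin mulr_gt0// invr_gt0 mulr_gt0.
apply: limn_einf_ge.
near=> n.
have rn : varrho / 2 < vnorm (rho n) by near: n; apply: (cvgr_gt varrho) => //; lra.
have rn' : vnorm (rho n) < 2 * varrho by near: n; apply: (cvgr_lt varrho) => //; lra.
have pn : c / 2 < (p n)%:R / n%:R by near: n; apply: (cvgr_gt c) => //; lra.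
(* Together with [p / n > c / 2] this gives [p > 2], so there is a direction orthogonal to [e]. *)
have nc : 4 / c <= n%:R by near: n; exact: nbhs_infty_ger.
have n0 : 0 < n%:R :> R by rewrite (lt_le_trans _ nc)// divr_gt0.
have p1 : (1 < p n)%N.
  rewrite -(ltr_nat R); move: pn; rewrite ltr_pdivlMr// => /(le_lt_trans _); apply.
  have : 4 <= n%:R * c by rewrite -ler_pdivrMr.
  lra.
have r0 : 0 < vnorm (rho n) by lra.
apply: (@vangle_expect_ge R d T P n (p n) (rho n) sigma (v n) (z n) (rhohat n)
  m2 m4 C K t) => //.
- by rewrite -(ltr_nat R).
- by move=> w; apply: top; exact: ltnW.
- rewrite ler_pdivrMr// (_ : (16 * C)^-1 * K = M); last first.
    by rewrite /K; field; rewrite gt_eqF.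
  rewrite /M ler_wpM2r ?(ltW m2_gt0)// lerD2r ler_wpM2l//.
  by rewrite ler_pXn2r ?nnegrE ?mulr_ge0 ?ltW.
- rewrite /t ler_pdivrMr// divfK// ler_wpM2r ?sqr_ge0//.
  apply: ler_pM; rewrite ?sqr_ge0 ?divr_ge0 ?ltW//.
  by rewrite ltr_pXn2r ?nnegrE ?mulr_ge0 ?divr_ge0 ?(ltW s0) ?(ltW vr0)
    ?(ltW r0)// ltr_pM2l.
Unshelve. all: by end_near.
Qed.
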